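(* Let $0\le q<1$. The Jacobi theta functions, defined for $z\in\mathbb{C}$ by $$\vartheta_1\!\left(z+\tfrac{\pi}{2},q\right)=\vartheta_2(z,q)=\sum_{n=-\infty}^\infty q^{(n+1/2)^2}e^{i(2n+1)z},\qquad \vartheta_3(z,q)=\vartheta_4\!\left(z+\tfrac{\pi}{2},q\right)=\sum_{n=-\infty}^\infty q^{n^2}e^{i2nz},$$ satisfy the following asymptotic relations at $q=1$: $$\vartheta_1\!\left(z+\tfrac{\pi}{2},q\right)=\vartheta_2(z,q)\simeq\sqrt{\frac{\pi}{\log(1/q)}}\left[e^{\frac{z_\pi^2}{\log q}}-e^{\frac{(\pi-z_\pi)^2}{\log q}}\right](-1)^{\lfloor\frac{z}{\pi}\rfloor}$$ and $$\vartheta_3(z,q)=\vartheta_4\!\left(z+\tfrac{\pi}{2},q\right)\simeq\sqrt{\frac{\pi}{\log(1/q)}}\left[e^{\frac{z_\pi^2}{\log q}}+e^{\frac{(\pi-z_\pi)^2}{\log q}}\right],$$ where $z_\pi$ is $z$ mod $\pi$, and $\lfloor\frac{z}{\pi}\rfloor$ is the floor of $\frac{z}{\pi}$.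
   Context: The symbol $\simeq$ indicates asymptotic equality in the limit $q\to1^-$. The reduction of $z$ modulo $\pi$ is taken to the range from $0$ (included) to $\pi$ (excluded). *)

(* Defs.v *)
From HB Require Import structures.
From mathcomp Require Import all_boot all_order all_algebra.
From mathcomp Require Import all_classical all_reals all_analysis.
From mathcomp Require Export complex.

Set Implicit Arguments.
Unset Strict Implicit.
Unset Printing Implicit Defensive.

Import Order.TTheory GRing.Theory Num.Theory.
Import numFieldNormedType.Exports.

Local Open Scope classical_set_scope.
Local Open Scope ring_scope.
Local Open Scope complex_scope.

Definition cexp (R : realType) (z : R[i]) : R[i] :=
  (expR (complex.Re z) * cos (complex.Im z)) +i*
  (expR (complex.Re z) * sin (complex.Im z)).

Definition bisum (R : realType) (u : int -> R[i]) : R[i] :=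
  lim (series (fun n : nat => u n%:Z : R[i]^o) @ \oo) +
  lim (series (fun n : nat => u (- n.+1%:Z) : R[i]^o) @ \oo).

(* The real power `^ satisfies 0 `^ 0 = 1 and 0 `^ a = 0 for a <> 0, so the
   two series below have the intended terms at q = 0 as well. *)
Definition theta2 (R : realType) (z : R[i]) (q : R) : R[i] :=
  bisum (fun n : int =>
    (q `^ ((n%:~R + 2^-1) ^+ 2))%:C * cexp ('i%C * (2 * n + 1)%:~R * z)).

Definition theta3 (R : realType) (z : R[i]) (q : R) : R[i] :=
  bisum (fun n : int => (q `^ (n%:~R ^+ 2))%:C * cexp ('i%C * (2 * n)%:~R * z)).

Definition theta1 (R : realType) (z : R[i]) (q : R) : R[i] :=
  theta2 (z - (pi / 2)%:C) q.

Definition theta4 (R : realType) (z : R[i]) (q : R) : R[i] :=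
  theta3 (z - (pi / 2)%:C) q.

(* For nonreal z, the floor of z / pi is that of its real part, so that
   mod_pi z is the translate of z by an integer multiple of pi whose real part
   lies in [0, pi[. *)
Definition floor_pi (R : realType) (z : R[i]) : int :=
  Num.floor (complex.Re (z / pi%:C)).

Definition mod_pi (R : realType) (z : R[i]) : R[i] :=
  z - (floor_pi z)%:~R * pi%:C.

(* Asymptotic equality as q tends to 1 from below, in the form
   f = g + o(g): unlike "f / g tends to 1", it makes sense when g vanishes,
   as it does for theta2 at z = pi / 2. *)
Definition asymp_eq1 (R : realType) (f g : R -> R[i]) : Prop :=
  (f : R -> R[i]^o) ~_(1^'-) (g : R -> R[i]^o).

Definition theta2_asymp (R : realType) (z : R[i]) (q : R) : R[i] :=
  (Num.sqrt (pi / ln (1 / q)))%:C *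
  (cexp (mod_pi z ^+ 2 / (ln q)%:C) -
   cexp ((pi%:C - mod_pi z) ^+ 2 / (ln q)%:C)) *
  (-1) ^ floor_pi z.

Definition theta3_asymp (R : realType) (z : R[i]) (q : R) : R[i] :=
  (Num.sqrt (pi / ln (1 / q)))%:C *
  (cexp (mod_pi z ^+ 2 / (ln q)%:C) +
   cexp ((pi%:C - mod_pi z) ^+ 2 / (ln q)%:C)).

(* Main.v *)
Require Import Defs.
From mathcomp Require Import all_boot all_order all_algebra.
From mathcomp Require Import all_classical all_reals all_analysis.
From mathcomp Require Import complex ring lra zify.
Set Implicit Arguments.
Unset Strict Implicit.
Unset Printing Implicit Defensive.

(** Put q = exp (-t), so that q -> 1 from below means t -> 0 from above. The
    series defining theta3 converges ever more slowly as t -> 0, but Jacobi's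
    imaginary transformation rewrites it as a sum of Gaussians that becomes ever
    sparser:

      theta3(z, q) = sqrt (pi / t) * sum over k in Z of exp (- (z + k pi)^2 / t).

    After z is moved to w = z mod pi, the terms k = 0 and k = -1 are the two
    exponentials of the asymptotic formula, and everything else is negligible.
    The error has to be small relative to the sum of these two terms, and this
    sum can vanish for t arbitrarily close to 0 (when Re w = pi / 2). The way out
    is to group the remaining terms in pairs {n, -n-1}. With
    P = exp ((2 pi w - pi^2) / t), the pair of index n is a multiple of
    1 + e P^(2n+1), where e = 1 for theta3 and e = -1 for theta2, and the
    leading pair n = 0 is a multiple of 1 + e P. Since 1 + e P divides
    1 + e P^(2n+1), every pair is the leading one times a quotient of modulus at
    most (2n+1) exp (-pi^2 n^2 / t), uniformly in 0 <= Re w <= pi (gauss_pair).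
    Summing over n >= 1 gives a relative error of at most 6 t
    (gauss_bisum_first_pair), which covers all complex z at once.

    The transformation (jacobi_identity) is proved for complex z by Polya's
    elementary argument. Expand (2 cos ((z + k pi) / l))^(2m) by the binomial
    theorem and sum over k modulo l: the sum over roots of unity keeps the
    frequencies divisible by l, which leaves
    l * sum over n of binom (2m, m + l n) exp (2 i n z) (polya_identity). Let l
    tend to infinity with l^2 / m -> t. Normalised powers of cosine tend to
    Gaussians (cvg_cosh_pow), binomial ratios tend to exp (-n^2 t)
    (cvg_binratio), and Tannery's theorem passes to the limit in both sums
    (cvg_polya_gauss, cvg_polya_theta). The constant produced in this way is
    sqrt (V / t), where V is the limit of 16^m / (m binom (2m, m)^2). At z = 0
    and t = pi both sides of the transformation are the same nonzero series,
    hence V = pi (wallis_lim): Wallis' formula is a consequence of the argument.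

    Finally theta2(z, q) = exp (-t/4) exp (i z) theta3 (z + i t / 2, q), so the
    transformation of theta2 is that of theta3 at a shifted complex point, where
    the shift turns the Gaussians into Gaussians weighted by (-1)^k. *)

Import Order.TTheory GRing.Theory Num.Theory.
Import numFieldNormedType.Exports.
Local Open Scope classical_set_scope.
Local Open Scope ring_scope.
Local Open Scope complex_scope.

Local Notation cabs := ComplexField.Normc.normc.

(** * The complex exponential and the modulus *)

Section ComplexExp.
Variable R : realType.
Implicit Types (z w : R[i]) (x y : R).

Lemma normCE z : `|z| = (cabs z)%:C. Proof. by rewrite normc_def; case: z. Qed.

Lemma cabs_ge0 z : 0 <= cabs z.
Proof. by rewrite -lecR -normCE normr_ge0. Qed.

Lemma cabsM z w : cabs (z * w) = cabs z * cabs w.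
Proof. exact: ComplexField.Normc.normcM. Qed.

Lemma cabsD z w : cabs (z + w) <= cabs z + cabs w.
Proof. by rewrite -lecR rmorphD -!normCE ler_normD. Qed.

Lemma cabsX z n : cabs (z ^+ n) = cabs z ^+ n.
Proof. by apply: complexI; rewrite rmorphXn -!normCE normrX. Qed.

Lemma cabsC x : cabs x%:C = `|x|.
Proof. by rewrite /cabs /= expr0n addr0 sqrtr_sqr. Qed.

Lemma realC_neq0 x : 0 < x -> x%:C != 0.
Proof. by move=> x0; rewrite -(rmorph0 (real_complex R)) (inj_eq (@complexI R)) gt_eqF. Qed.

Lemma cabs_involution z : z ^+ 2 = 1 -> cabs z = 1.
Proof.
move=> z2; have : cabs z ^+ 2 = 1.
  by rewrite -cabsX z2 -[1](rmorph1 (real_complex R)) cabsC normr1.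
move/eqP; rewrite sqrf_eq1 => /orP[/eqP //|/eqP z1].
by have := cabs_ge0 z; rewrite z1; lra.
Qed.

Lemma cabs_Re z : `|complex.Re z| <= cabs z.
Proof. by rewrite -lecR -normCE normc_ge_Re. Qed.

Lemma cabs_Im z : `|complex.Im z| <= cabs z.
Proof.
case: z => a b; rewrite /= -sqrtr_sqr ler_wsqrtr //.
by rewrite lerDr sqr_ge0.
Qed.

Lemma Re_divC z x : complex.Re (z / x%:C) = complex.Re z / x.
Proof.
by rewrite -(fmorphV (real_complex R)); case: z => a b /=; rewrite mulr0 subr0.
Qed.

Lemma Im_divC z x : complex.Im (z / x%:C) = complex.Im z / x.
Proof.
by rewrite -(fmorphV (real_complex R)); case: z => a b /=; rewrite mulr0 add0r.
Qed.

Lemma cexpD z w : cexp (z + w) = cexp z * cexp w.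
Proof.
case: z w => [a b] [c d]; rewrite /cexp /= expRD cosD sinD.
by apply/eqP; rewrite eq_complex /=; apply/andP; split; apply/eqP; ring.
Qed.

Lemma cexp_real x : cexp x%:C = (expR x)%:C.
Proof. by rewrite /cexp /= cos0 sin0 mulr1 mulr0. Qed.

Lemma cexp0 : cexp 0 = 1 :> R[i].
Proof. by rewrite (cexp_real 0) expR0. Qed.

Lemma cexpNK z : cexp z * cexp (- z) = 1.
Proof. by rewrite -cexpD subrr cexp0. Qed.

Lemma cexp_neq0 z : cexp z != 0.
Proof.
by apply/eqP => z0; move/eqP: (cexpNK z); rewrite z0 mul0r eq_sym oner_eq0.
Qed.

Lemma cexpMn n z : cexp (n%:R * z) = cexp z ^+ n.
Proof.
elim: n => [|n IH]; first by rewrite mul0r cexp0 expr0.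
by rewrite -natr1 mulrDl mul1r cexpD IH exprSr.
Qed.

Lemma cabs_cexp z : cabs (cexp z) = expR (complex.Re z).
Proof.
case: z => a b; rewrite /cexp /= !exprMn -mulrDr cos2Dsin2 mulr1.
by rewrite sqrtr_sqr ger0_norm ?expR_ge0.
Qed.

Lemma cexp_2pi (n : int) : cexp ('i%C * (2 * n)%:~R * pi%:C) = 1 :> R[i].
Proof.
have H k : cexp ('i%C * (2 * k%:Z)%:~R * pi%:C) = 1 :> R[i].
  suff E : cexp ('i%C * 2 * pi%:C) = 1 :> R[i].
    have -> : 'i%C * (2 * k%:Z)%:~R * pi%:C = k%:R * ('i%C * 2 * pi%:C) :> R[i].
      by rewrite intrM; ring.
    by rewrite cexpMn E expr1n.
  have -> : 'i%C * 2 * pi%:C = 0 +i* (pi *+ 2) :> R[i].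
    apply/eqP; rewrite eq_complex /=; apply/andP; split; apply/eqP; ring.
  by rewrite /cexp /= expR0 cos2pi sin2pi mulr0 mulr1.
case: n => k; first exact: H.
have := cexpNK ('i%C * (2 * k.+1%:Z)%:~R * pi%:C).
rewrite H mul1r => E; rewrite -[RHS]E; congr cexp.
by rewrite NegzE (mulrN 2) intrN mulrN mulNr.
Qed.

End ComplexExp.

(** * Convergence in the complex plane *)

Section ComplexLimits.
Context (R : realType) (T : Type) (F : set_system T) {FF : Filter F}.
Implicit Types (f g : T -> R[i]) (a : R[i]).

Lemma cvgC_cabs f a : (fun x => cabs (f x - a)) @ F --> (0 : R) ->
  (f : T -> R[i]^o) @ F --> (a : R[i]^o).
Proof.
move=> /cvgrPdist_le fa; apply/cvgrPdist_le => e e0.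
have ee : e = (complex.Re e)%:C by rewrite RRe_real // gtr0_real.
have e'0 : 0 < complex.Re e by rewrite -ltcR -ee.
near=> x; rewrite distrC normCE ee lecR.
have : `|0 - cabs (f x - a)| <= complex.Re e by near: x; exact: fa.
by rewrite sub0r normrN; apply: le_trans; exact: ler_norm.
Unshelve. all: by end_near. Qed.

Lemma cvgC_cabsP f a : (f : T -> R[i]^o) @ F --> (a : R[i]^o) ->
  (fun x => cabs (f x - a)) @ F --> (0 : R).
Proof.
move=> /cvgrPdist_le fa; apply/cvgrPdist_le => e e0.
near=> x; rewrite sub0r normrN ger0_norm ?cabs_ge0 // -lecR -normCE distrC.
by near: x; apply: fa; rewrite ltcR.
Unshelve. all: by end_near. Qed.

Lemma cvgC_ReIm f a : (fun x => complex.Re (f x)) @ F --> complex.Re a ->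
  (fun x => complex.Im (f x)) @ F --> complex.Im a ->
  (f : T -> R[i]^o) @ F --> (a : R[i]^o).
Proof.
move=> fR fI; apply: cvgC_cabs.
have sq (u : T -> R) l : u @ F --> l -> (fun x => (u x - l) ^+ 2) @ F --> (0 : R).
  move=> ul; have -> : 0 = (l - l) * (l - l) :> R by rewrite subrr mulr0.
  under eq_fun do rewrite expr2.
  by apply: cvgM; apply: cvgB => //; exact: cvg_cst.
have H : (fun x => Num.sqrt ((complex.Re (f x) - complex.Re a) ^+ 2 +
    (complex.Im (f x) - complex.Im a) ^+ 2)) @ F --> (0 : R).
  rewrite -(@sqrtr0 R); apply: continuous_cvg; first exact: sqrt_continuous.
  by rewrite -[X in _ --> X](addr0 (0 : R)); apply: cvgD; exact: sq.
apply: cvg_trans H; apply: near_eq_cvg; near=> x.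
by case: (f x) => ? ?; case: {fR fI} a.
Unshelve. all: by end_near. Qed.

Lemma cvgC_Re f a : (f : T -> R[i]^o) @ F --> (a : R[i]^o) ->
  (fun x => complex.Re (f x)) @ F --> complex.Re a.
Proof.
move=> /cvgC_cabsP /cvgrPdist_le fa; apply/cvgrPdist_le => e e0.
near=> x; rewrite distrC -raddfB (le_trans (cabs_Re _))//.
have : `|0 - cabs (f x - a)| <= e by near: x; exact: fa.
by rewrite sub0r normrN ger0_norm // cabs_ge0.
Unshelve. all: by end_near. Qed.

Lemma cvgC_Im f a : (f : T -> R[i]^o) @ F --> (a : R[i]^o) ->
  (fun x => complex.Im (f x)) @ F --> complex.Im a.
Proof.
move=> /cvgC_cabsP /cvgrPdist_le fa; apply/cvgrPdist_le => e e0.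
near=> x; rewrite distrC -raddfB (le_trans (cabs_Im _))//.
have : `|0 - cabs (f x - a)| <= e by near: x; exact: fa.
by rewrite sub0r normrN ger0_norm // cabs_ge0.
Unshelve. all: by end_near. Qed.

Lemma cvgC_real (f : T -> R) (a : R) : f @ F --> a ->
  ((fun x => (f x)%:C) : T -> R[i]^o) @ F --> (a%:C : R[i]^o).
Proof. by move=> fa; apply: cvgC_ReIm => //=; exact: cvg_cst. Qed.

Lemma cvg_cabs f a : (f : T -> R[i]^o) @ F --> (a : R[i]^o) ->
  (fun x => cabs (f x)) @ F --> cabs a.
Proof.
move=> /cvg_norm /cvgC_Re H.
by apply: cvg_trans H; apply: near_eq_cvg; near=> x.
Unshelve. all: by end_near. Qed.

End ComplexLimits.

(** The derivative of cexp at 0 is 1. Only increments along the real line are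
    needed, so real and imaginary parts are real derivatives. *)
Lemma cvg_cexp_slope (R : realType) (T : Type) (F : set_system T)
    {FF : Filter F} (h : T -> R) (z : R[i]) : h @ F --> (0 : R)^' ->
  ((fun x => (cexp ((h x)%:C * z) - 1) / (h x)%:C) : T -> R[i]^o) @ F
    --> (z : R[i]^o).
Proof.
case: z => a b hF.
have slope (f : R -> R) (d : R) : is_derive (0 : R) (1 : R) f d ->
    (fun x => (f (h x) - f 0) / h x) @ F --> d.
  move=> [fd fE]; have := fd; rewrite /derivable => fd'.
  have fl : (fun u : R => u^-1 *: (f (u *: 1 + 0) - f 0)) @ 0^' --> d.
    by rewrite -fE; exact: fd.
  have := cvg_comp _ _ hF fl; apply: cvg_trans; apply: near_eq_cvg.
  by near=> x => /=; rewrite addr0 [_ *: 1]mulr1 [_ *: (_ - _)]mulrC.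
have lin c : is_derive (0 : R) (1 : R) ( *%R c) c.
  by have := @is_deriveZ R R R id c 0 1 _ (@is_derive_id R R (0 : R) (1 : R)); rewrite [_ *: 1]mulr1.
have EC : is_derive (0 : R) (1 : R)
    ((expR \o ( *%R a)) * (cos \o ( *%R b))) a.
  apply: is_derive_eq.
  by rewrite /= !mulr0 expR0 cos0 sin0 /GRing.scale /=; ring.
have ES : is_derive (0 : R) (1 : R)
    ((expR \o ( *%R a)) * (sin \o ( *%R b))) b.
  apply: is_derive_eq.
  by rewrite /= !mulr0 expR0 cos0 sin0 /GRing.scale /=; ring.
have h0 : \forall x \near F, h x != 0.
  suff : \forall u \near (0 : R)^', u != 0 by exact: hF.
  exact: nbhs_dnbhs_neq.
apply: cvgC_ReIm.
- apply: cvg_trans (slope _ _ EC); apply: near_eq_cvg; near=> x.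
  have hx : h x != 0 by near: x.
  rewrite Re_divC; congr (_ / _).
  rewrite -[LHS]/(expR (a * h x) * cos (b * h x) - expR (a * 0) * cos (b * 0)).
  by rewrite /cexp /= !mulr0 expR0 cos0 !mul0r subr0 addr0 mulr1 ![h x * _]mulrC.
- apply: cvg_trans (slope _ _ ES); apply: near_eq_cvg; near=> x.
  have hx : h x != 0 by near: x.
  rewrite Im_divC; congr (_ / _).
  rewrite -[LHS]/(expR (a * h x) * sin (b * h x) - expR (a * 0) * sin (b * 0)).
  by rewrite /cexp /= !mulr0 expR0 sin0 !mul0r !subr0 addr0 mulr0 subr0
     ![h x * _]mulrC.
Unshelve. all: by end_near. Qed.

(** * Tannery's theorem *)

(** The number of summands N L may vary with L: the head of the sum converges
    termwise, and the tails of both sums are bounded by the tail of M. *)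
Lemma tannery (R : realType) (a : nat -> nat -> R) (b M : nat -> R)
    (N : nat -> nat) :
  (forall n, a ^~ n @ \oo --> b n) ->
  (\forall L \near \oo, forall n, (n < N L)%N -> `|a L n| <= M n) ->
  cvgn (series M) -> N L @[L --> \oo] --> \oo ->
  cvgn (series b) /\ series (a L) (N L) @[L --> \oo] --> limn (series b).
Proof.
move=> ab aM cM NN.
have Ngt n : \forall L \near \oo, (n < N L)%N.
  have : \forall k \near \oo, (n < k)%N by exists n.+1.
  exact: NN.
have bM n : `|b n| <= M n.
  have /cvg_norm abn := ab n.
  apply: (cvgr_to_le abn).
  near=> L.
  have aML : forall k, (k < N L)%N -> `|a L k| <= M k by near: L.
  by apply: aML; near: L; exact: Ngt.
have M0 n : 0 <= M n by exact: le_trans (bM n).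
have cb : cvgn (series b).
  apply: normed_cvg; by apply: (@series_le_cvg R _ M) => // n /=; exact: normr_ge0.
split=> //.
apply/cvgrPdist_le => e e0.
have e3 : 0 < e / 3 by rewrite divr_gt0.
have [K _ HK] : \forall K \near \oo, `|limn (series M) - series M K| <= e / 3.
  by move/cvgrPdist_le : cM; exact.
have tailM n : (K <= n)%N -> series M n - series M K <= e / 3.
  move=> Kn; apply: le_trans (HK K (leqnn K)).
  rewrite (le_trans _ (ler_norm _)) // lerD2r.
  apply: nondecreasing_cvgn_le => //.
  by apply: nondecreasing_series => *.
have dom (u : nat -> R) n : (K <= n)%N -> (forall k, (k < n)%N -> `|u k| <= M k) ->
    `|series u n - series u K| <= e / 3.
  move=> Kn uM; apply: le_trans (tailM _ Kn).
  rewrite !sub_series_geq //.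
  apply: le_trans (ler_norm_sum _ _ _) _.
  rewrite !big_nat; apply: ler_sum => k /andP[_ kn]; exact: uM.
have tailb : `|limn (series b) - series b K| <= e / 3.
  have : `|series b n - series b K| @[n --> \oo] --> `|limn (series b) - series b K|.
    by apply: cvg_norm; apply: cvgB => //; exact: cvg_cst.
  move=> H; apply: (cvgr_to_le H).
  by near=> n; apply: dom => //; near: n; exists K.
have headc K' : series (a L) K' @[L --> \oo] --> series b K'.
  elim: K' => [|K' IH].
    by rewrite /series /= big_geq //; under eq_fun do rewrite big_geq //; exact: cvg_cst.
  by rewrite seriesSr; under eq_fun do rewrite seriesSr; apply: cvgD.
near=> L.
have aML : forall k, (k < N L)%N -> `|a L k| <= M k by near: L.
have KN : (K <= N L)%N by apply: ltnW; near: L; exact: Ngt.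
have h1 := dom _ _ KN aML.
have h2 : `|series b K - series (a L) K| <= e / 3.
  by near: L; move/cvgrPdist_le : (headc K); exact.
have -> : limn (series b) - series (a L) (N L) = (limn (series b) - series b K) +
  (series b K - series (a L) K) - (series (a L) (N L) - series (a L) K) by ring.
rewrite (le_trans (ler_normB _ _)) // (le_trans (lerD (ler_normD _ _) h1)) //.
by lra.
Unshelve. all: by end_near. Qed.

Lemma Re_series (R : realType) (u : nat -> R[i]) n :
  complex.Re (series (u : nat -> R[i]^o) n) = series (fun k => complex.Re (u k)) n.
Proof. by rewrite /series /=; elim/big_rec2 : _ => //= i x y _ <-; rewrite raddfD. Qed.

Lemma Im_series (R : realType) (u : nat -> R[i]) n :
  complex.Im (series (u : nat -> R[i]^o) n) = series (fun k => complex.Im (u k)) n.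
Proof. by rewrite /series /=; elim/big_rec2 : _ => //= i x y _ <-; rewrite raddfD. Qed.

(** Real and imaginary parts are dominated by the modulus, which reduces the
    complex case to the real one. *)
Lemma tannery_complex (R : realType) (a : nat -> nat -> R[i]) (b : nat -> R[i])
    (M : nat -> R) (N : nat -> nat) :
  (forall n, ((fun L => a L n) : nat -> R[i]^o) @ \oo --> (b n : R[i]^o)) ->
  (\forall L \near \oo, forall n, (n < N L)%N -> cabs (a L n) <= M n) ->
  cvgn (series M) -> N L @[L --> \oo] --> \oo ->
  cvgn (series (b : nat -> R[i]^o)) /\
  ((fun L => series (a L : nat -> R[i]^o) (N L)) : nat -> R[i]^o) @ \oo -->
    (limn (series (b : nat -> R[i]^o)) : R[i]^o).
Proof.
move=> ab aM cM NN.
have [cR lR] : cvgn (series (fun n => complex.Re (b n))) /\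
   series (fun n => complex.Re (a L n)) (N L) @[L --> \oo] --> limn (series (fun n => complex.Re (b n))).
  apply: tannery cM NN => [n|]; first exact: cvgC_Re.
  by apply: filterS aM => L H n nN; apply: le_trans (cabs_Re _) (H _ nN).
have [cI lI] : cvgn (series (fun n => complex.Im (b n))) /\
   series (fun n => complex.Im (a L n)) (N L) @[L --> \oo] --> limn (series (fun n => complex.Im (b n))).
  apply: tannery cM NN => [n|]; first exact: cvgC_Im.
  by apply: filterS aM => L H n nN; apply: le_trans (cabs_Im _) (H _ nN).
pose S := limn (series (fun n => complex.Re (b n))) +i* limn (series (fun n => complex.Im (b n))).
have cS : series (b : nat -> R[i]^o) @ \oo --> (S : R[i]^o).
  by apply: cvgC_ReIm; [under eq_fun do rewrite Re_series | under eq_fun do rewrite Im_series].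
split; first by apply/cvg_ex; exists S.
rewrite (cvg_lim _ cS) //.
by apply: cvgC_ReIm; [under eq_fun do rewrite Re_series | under eq_fun do rewrite Im_series].
Qed.

Lemma cvg_series_geometric_cst (R : realType) (C r : R) : 0 <= r < 1 ->
  cvgn (series (fun n => C * r ^+ n)).
Proof.
move=> /andP[r0 r1]; apply: (@is_cvg_geometric_series _ C).
by rewrite ger0_norm.
Qed.

(** The terms of index n and -n-1 are added together, so that bipart u N ranges
    over the integers of the interval from -N to N-1. *)
Definition bipart (R : realType) (u : int -> R[i]) (N : nat) : R[i] :=
  \sum_(0 <= n < N) (u n%:Z + u (- n.+1%:Z)).

(** A geometric bound suffices for Gaussian terms, as n^2 >= n makes their decay
    at least geometric. *)
Lemma bisum_tannery (R : realType) (a : nat -> int -> R[i]) (b : int -> R[i])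
    (C r : R) (N : nat -> nat) :
  (forall n, ((fun L => a L n) : nat -> R[i]^o) @ \oo --> (b n : R[i]^o)) ->
  0 <= r < 1 ->
  (\forall L \near \oo, forall n, (n < N L)%N ->
     cabs (a L n%:Z) <= C * r ^+ n /\ cabs (a L (- n.+1%:Z)) <= C * r ^+ n) ->
  N L @[L --> \oo] --> \oo ->
  ((fun L => bipart (a L) (N L)) : nat -> R[i]^o) @ \oo --> (bisum b : R[i]^o).
Proof.
move=> ab r01 aM NN.
have gM := @cvg_series_geometric_cst R C r r01.
have [_ lP] : _ /\ _ := tannery_complex (fun n => ab n%:Z)
  (filterS (fun L H n nN => proj1 (H n nN)) aM) gM NN.
have [_ lN] : _ /\ _ := tannery_complex (fun n => ab (- n.+1%:Z))
  (filterS (fun L H n nN => proj2 (H n nN)) aM) gM NN.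
apply: cvg_trans (cvgD lP lN); apply: near_eq_cvg; near=> L.
by rewrite /bipart big_split.
Unshelve. all: by end_near. Qed.

(** * The limit of (1 + c / m)^m *)

Lemma eventually_gt0 (k : nat -> nat) : k L @[L --> \oo] --> \oo ->
  \forall L \near \oo, (0 < k L)%N.
Proof.
move=> koo; have : \forall n \near \oo, (0 < n)%N by exists 1%N.
exact: koo.
Qed.

Section PowerLimit.
Variable R : realType.

Lemma cabs_subX (a b : R[i]) (K : R) m : 1 <= K -> cabs a <= K -> cabs b <= K ->
  cabs (a ^+ m - b ^+ m) <= K ^+ m * (m%:R * cabs (a - b)).
Proof.
move=> K1 aK bK; have K0 : 0 <= K by exact: le_trans K1.
rewrite subrXX cabsM mulrC.
rewrite [leRHS](_ : _ = (m%:R * K ^+ m) * cabs (a - b)); last by ring.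
rewrite ler_wpM2r ?cabs_ge0 //.
rewrite -lecR -normCE (le_trans (ler_norm_sum _ _ _)) //.
rewrite -[m in m%:R]card_ord -sum1_card natr_sum mulr_suml rmorph_sum.
apply: ler_sum => i _; rewrite mul1r normrM !normrX !normCE -!rmorphXn -rmorphM lecR.
have im : (i < m)%N by [].
have -> : K ^+ m = K ^+ (m.-1 - i) * (K * K ^+ i).
  by rewrite -exprS -exprD; congr (_ ^+ _); lia.
apply: ler_pM; rewrite ?exprn_ge0 ?cabs_ge0 //.
  by rewrite lerXn2r // nnegrE cabs_ge0.
rewrite -[leLHS]mul1r ler_pM // ?exprn_ge0 ?cabs_ge0 //.
by rewrite lerXn2r // nnegrE cabs_ge0.
Qed.

Lemma cvg_invn0 (m : nat -> nat) : m L @[L --> \oo] --> \oo ->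
  (m L)%:R^-1 @[L --> \oo] --> (0 : R)^'.
Proof.
move=> moo.
have H : (m L)%:R^-1 @[L --> \oo] --> (0 : R).
  apply: (cvg_comp _ _ moo (_ : (fun n => n%:R^-1 : R) @ \oo --> (0 : R))).
  rewrite -cvg_shiftS; exact: cvg_harmonic.
move=> A hA.
have m1 := eventually_gt0 moo.
have := H _ hA; apply: filter_app; apply: filterS m1 => L mL.
by apply; rewrite invr_eq0 pnatr_eq0 -lt0n.
Qed.

(** No complex logarithm is involved: (1 + c/m)^m is compared with
    cexp (c0 / m) ^ m = cexp c0. The two bases have modulus at most exp (K / m)
    and differ by o(1/m), so that their m-th powers differ by o(1). *)
Lemma cvg_expr_cexp (c : nat -> R[i]) (c0 : R[i]) (m : nat -> nat) :
  m L @[L --> \oo] --> \oo -> (c : nat -> R[i]^o) @ \oo --> (c0 : R[i]^o) ->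
  ((fun L => (1 + c L / (m L)%:R) ^+ m L) : nat -> R[i]^o) @ \oo -->
    (cexp c0 : R[i]^o).
Proof.
move=> moo cc.
have h0 := cvg_invn0 moo.
have slope : ((fun L => (cexp ((m L)%:R^-1%:C * c0) - 1) / (m L)%:R^-1%:C) : nat -> R[i]^o)
    @ \oo --> (c0 : R[i]^o) by exact: cvg_cexp_slope.
have m1 := eventually_gt0 moo.
have [K KE] : exists K, K = cabs c0 + 1 by eexists.
have cK : \forall L \near \oo, cabs (c L) <= K.
  have : cabs c0 < K by rewrite KE ltrDl.
  move/(cvgr_lt _ (cvg_cabs cc)); apply: filterS => L; exact: ltW.
have cd : expR K * cabs (c L - (cexp ((m L)%:R^-1%:C * c0) - 1) / ((m L)%:R^-1)%:C)
   @[L --> \oo] --> (0 : R).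
  rewrite -[X in _ --> X](mulr0 (expR K)); apply: cvgM; first exact: cvg_cst.
  rewrite [X in _ --> X](_ : 0 = cabs (c0 - c0)).
    by apply: cvg_cabs; exact: (cvgB cc slope).
  by rewrite subrr -[X in cabs X](rmorph0 (real_complex R)) cabsC normr0.
apply: cvgC_cabs.
apply: squeeze_cvgr (cvg_cst 0) cd.
near=> L.
have mL : (0 < m L)%N by near: L.
have mC : (m L)%:R != 0 :> R by rewrite pnatr_eq0 -lt0n.
have mCC : (m L)%:R != 0 :> R[i] by rewrite pnatr_eq0 -lt0n.
rewrite cabs_ge0 /=.
pose h : R := (m L)%:R^-1; rewrite -/h.
have hm : h%:C = (m L)%:R^-1 by rewrite /h fmorphV rmorph_nat.
have -> : cexp c0 = cexp (h%:C * c0) ^+ m L.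
  by rewrite -cexpMn hm mulrA divff // mul1r.
have K0 : 0 <= K by rewrite KE addr_ge0 ?cabs_ge0.
have h00 : 0 <= h by rewrite invr_ge0 ler0n.
have eK : expR K = expR (h * K) ^+ m L.
  rewrite -expRM_natl; congr expR.
  by rewrite mulrA /h mulfV // mul1r.
rewrite eK.
have -> : cabs (c L - (cexp (h%:C * c0) - 1) / h%:C) =
  (m L)%:R * cabs (1 + c L / (m L)%:R - cexp (h%:C * c0)).
  rewrite -[(m L)%:R in RHS]ger0_norm ?ler0n // -cabsC -cabsM rmorph_nat.
  congr cabs; rewrite hm invrK mulrBr mulrDr mulr1 mulrCA divff // mulr1.
  by rewrite mulrC [_ * (_ - 1)]mulrBr mulr1; ring.
apply: cabs_subX.
- by rewrite -expR0 ler_expR mulr_ge0.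
- rewrite (le_trans (cabsD _ _)) // cabsM -hm cabsC (ger0_norm h00) cabsC normr1.
  rewrite (le_trans _ (expR_ge1Dx _)) // lerD2l mulrC ler_wpM2l //.
  by near: L.
- rewrite cabs_cexp ler_expR.
  have -> : complex.Re (h%:C * c0) = h * complex.Re c0.
    by case: (c0) => a b /=; rewrite mul0r subr0.
  rewrite ler_wpM2l // (le_trans (ler_norm _)) // (le_trans (cabs_Re _)) //.
  by rewrite KE lerDl.
Unshelve. all: by end_near. Qed.

End PowerLimit.

(** * Binomial expansion summed over roots of unity *)

Section Polya.
Variable R : realType.
Implicit Types (s z : R[i]).

Lemma bipart_exchange (f : int -> int -> R[i]) N M :
  bipart (fun k => bipart (f k) N) M = bipart (fun n => bipart (f^~ n) M) N.
Proof.
rewrite /bipart.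
under eq_bigr do rewrite -big_split /=.
rewrite exchange_big /=; apply: eq_bigr => n _; rewrite -big_split /=.
by apply: eq_bigr => k _; ring.
Qed.

Lemma eq_bipart (f g : int -> R[i]) N : (forall k, f k = g k) -> bipart f N = bipart g N.
Proof. by move=> fg; apply: eq_bigr => n _; rewrite !fg. Qed.

Lemma bipart_mull c (f : int -> R[i]) N : bipart (fun k => c * f k) N = c * bipart f N.
Proof. by rewrite /bipart mulr_sumr; apply: eq_bigr => n _; rewrite mulrDr. Qed.

(** With s = i x the left-hand side is (2 cos x)^(2m). The bound N may exceed m
    because the binomial coefficients vanish beyond the range. *)
Lemma cos_pow_expand s m N : (m < N)%N ->
  (cexp s + cexp (- s)) ^+ (2 * m) =
  bipart (fun n => 'C(2 * m, m + `|n|)%:R * cexp ((2 * n)%:~R * s)) N.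
Proof.
move=> mN.
have EE := cexpNK s.
pose F i := cexp (- s) ^+ (2 * m - i) * cexp s ^+ i *+ 'C(2 * m, i).
have -> : (cexp s + cexp (- s)) ^+ (2 * m) = \sum_(0 <= i < (2 * m).+1) F i.
  by rewrite addrC exprDn big_mkord.
rewrite (@big_cat_nat _ _ _ m) //=; last by lia.
have hi : \sum_(m <= i < (2 * m).+1) F i =
   \sum_(0 <= n < N) 'C(2 * m, m + n)%:R * cexp ((2 * n%:Z)%:~R * s).
  rewrite -{1}[m]add0n big_addn (_ : (_ - _ = m.+1)%N); last by lia.
  rewrite [RHS](@big_cat_nat _ _ _ m.+1) //= [X in _ = _ + X]big1_seq ?addr0; last first.
    move=> n; rewrite mem_index_iota => /andP[_ /andP[mn _]].
    by rewrite bin_small ?mul0r //; lia.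
  rewrite !big_nat; apply: eq_bigr => n nm.
  rewrite /F -mulr_natl addnC; congr (_ * _).
  have -> : (2 * n%:Z)%:~R * s = (2 * n)%:R * s :> R[i] by rewrite intrM natrM.
  rewrite cexpMn (_ : (m + n = (2 * m - (m + n)) + 2 * n)%N); last by lia.
  rewrite {1}(_ : (2 * m - (2 * m - (m + n) + 2 * n) = (2 * m - (m + n)))%N); last by lia.
  by rewrite exprD mulrA -exprMn mulrC [cexp (- s) * _]mulrC EE expr1n mulr1.
have lo : \sum_(0 <= i < m) F i =
   \sum_(0 <= n < N) 'C(2 * m, m + n.+1)%:R * cexp ((2 * - n.+1%:Z)%:~R * s).
  rewrite big_nat_rev /=.
  rewrite [RHS](@big_cat_nat _ _ _ m) //=; last by lia.
  rewrite [X in _ = _ + X]big1_seq ?addr0; last first.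
    move=> n; rewrite mem_index_iota => /andP[_ /andP[mn _]].
    by rewrite bin_small ?mul0r //; lia.
  rewrite !big_nat; apply: eq_bigr => n nm.
  rewrite /F -mulr_natl -bin_sub; last by lia.
  rewrite (_ : (2 * m - (0 + m - n.+1) = m + n.+1)%N); last by lia.
  congr (_ * _).
  have -> : (2 * - n.+1%:Z)%:~R * s = (2 * n.+1)%:R * - s :> R[i].
    by rewrite mulrN intrN intrM natrM; ring.
  rewrite cexpMn (_ : (m + n.+1 = (0 + m - n.+1) + 2 * n.+1)%N); last by lia.
  by rewrite exprD mulrAC -exprMn [cexp (- s) * _]mulrC EE expr1n mul1r.
by rewrite hi lo addrC -big_split.
Qed.

(** If j = r mod l and the root of unity is 1, then cos (2 pi r / l) = 1, so
    sin (pi r / l) = 0 with 0 <= pi r / l < pi, which forces r = 0. *)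
Lemma cexp_root_unity_eq1 (j l : nat) : (0 < l)%N ->
  cexp ('i%C * (2 * j%:R * pi / l%:R)%:C) = 1 :> R[i] -> (l %| j)%N.
Proof.
move=> l0.
have l0' : l%:R != 0 :> R by rewrite pnatr_eq0 -lt0n.
have -> : 'i%C * (2 * j%:R * pi / l%:R)%:C =
   'i%C * (2 * (j %/ l)%N%:Z)%:~R * pi%:C + 'i%C * (2 * (j %% l)%N%:R * pi / l%:R)%:C :> R[i].
  rewrite {1}(divn_eq j l) natrD natrM.
  rewrite (_ : _ / l%:R = (2 * (j %/ l)%N%:Z)%:~R * pi + 2 * (j %% l)%N%:R * pi / l%:R).
    by rewrite rmorphD rmorphM rmorph_int mulrDr mulrA.
  by rewrite intrM; field.
rewrite cexpD cexp_2pi mul1r => /(congr1 (@complex.Re R)) /=.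
rewrite !mul0r mulr0 subr0 expR0 !mul1r add0r => cos1.
have [r0|r0] := posnP (j %% l)%N; first exact/eqP.
have rl := ltn_pmod j l0.
have : 0 < sin ((j %% l)%N%:R * pi / l%:R : R).
  apply: sin_gt0_pi; rewrite !divr_gt0 ?mulr_gt0 ?pi_gt0 ?ltr0n //=.
  by rewrite ltr_pdivrMr ?ltr0n // mulrC ltr_pM2l ?pi_gt0 // ltr_nat.
have : sin ((j %% l)%N%:R * pi / l%:R : R) ^+ 2 = 0.
  have := cos_mulr2n ((j %% l)%N%:R * pi / l%:R : R).
  rewrite [X in cos X = _](_ : _ = 2 * (j %% l)%:R * pi / l%:R) ?cos1 ?cos2sin2 ?mulr2n; last by ring.
  by move=> E; lra.
by move/eqP; rewrite sqrf_eq0 => /eqP ->; rewrite ltxx.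
Qed.

(** Orthogonality of characters modulo 2 L. When the root of unity cexp s is not
    1, multiplying the sum by cexp s - 1 makes it telescope to a difference that
    vanishes by periodicity. *)
Lemma bipart_root_unity (n : int) L : (0 < L)%N ->
  bipart (fun k => cexp (k%:~R * ('i%C * (2 * n%:~R * pi / (2 * L)%:R)%:C)) : R[i]) L =
  if (2 * L %| `|n|)%N then (2 * L)%:R else 0.
Proof.
move=> L0; set s := 'i%C * _.
have L0' : (2 * L)%:R != 0 :> R by rewrite pnatr_eq0; lia.
have tele M : (cexp s - 1) * bipart (fun k => cexp (k%:~R * s)) M =
    cexp (M%:R * s) - cexp (- (M%:R * s)).
  rewrite /bipart; elim: M => [|M IH].
    by rewrite big_nil mulr0 mul0r oppr0 subrr.
  rewrite big_nat_recr //= mulrDr IH mulrBl mul1r mulrDr -!cexpD.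
  have -> : s + M%:~R * s = M.+1%:R * s by rewrite -natr1 -[M%:~R]/(M%:R); ring.
  have -> : s + (- M.+1%:Z)%:~R * s = - (M%:R * s).
    by rewrite intrN -[M.+1%:~R]/(M.+1%:R) -natr1; ring.
  have -> : (- M.+1%:Z)%:~R * s = - (M.+1%:R * s).
    by rewrite intrN mulNr.
  by rewrite -[M%:~R]/(M%:R); ring.
have per : cexp (L%:R * s) = cexp (- (L%:R * s)).
  have E : L%:R * s = 'i%C * (2 * n)%:~R * pi%:C - L%:R * s.
    apply/eqP; rewrite eq_sym subr_eq -mulrDl -natrD addnn -mul2n /s.
    rewrite mulrCA -[(2 * L)%:R in X in _ == X](rmorph_nat (real_complex R)) -rmorphM.
    rewrite [X in _ == _ * X%:C](_ : _ = 2 * n%:~R * pi); last by rewrite mulrC mulfVK.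
    by rewrite !rmorphM /= !rmorph_int !rmorph_nat !mulrA.
  by rewrite {1}E cexpD cexp_2pi mul1r.
case: ifPn => [/dvdnP [q nq]|ndv].
  have s1 k : cexp (k%:~R * s) = 1.
    have [e ne] : exists e : int, n = e * (2 * L)%:Z.
      by exists (Num.sg n * q%:Z); rewrite -mulrA -PoszM -nq -numEsg.
    apply: etrans (cexp_2pi R (k * e)); rewrite /s ne; congr cexp.
    rewrite (_ : 2 * (e * (2 * L)%:Z)%:~R * pi / (2 * L)%:R = 2 * e%:~R * pi :> R); last first.
      by rewrite intrM -[(Posz _)%:~R]/((2 * L)%:R); rewrite [2 * (_ * _)]mulrA [_ * _ * pi]mulrAC mulfK.
    by rewrite !intrM !rmorphM /= !rmorph_int !rmorph_nat; ring.
  rewrite /bipart; under eq_bigr do rewrite !s1.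
  by rewrite sumr_const_nat subn0 mulnC natrM; ring.
have : (cexp s - 1) * bipart (fun k => cexp (k%:~R * s)) L = 0.
  by rewrite tele per subrr.
move=> /eqP; rewrite mulf_eq0 => /orP[|/eqP //].
rewrite subr_eq0 => /eqP s1.
suff : (2 * L %| `|n|)%N by rewrite (negPf ndv).
apply: cexp_root_unity_eq1; first by lia.
move: s1; rewrite /s; case: (n) => j s1; first exact: s1.
have := cexpNK ('i%C * (2 * (Negz j)%:~R * pi / (2 * L)%:R)%:C : R[i]).
rewrite s1 mul1r => E; apply: etrans E; congr cexp.
by rewrite NegzE intrN /= mulrN !mulNr rmorphN mulrN opprK.
Qed.

Lemma bipart_sieve (g : int -> R[i]) (l M : nat) : (0 < l)%N ->
  bipart (fun n => if (l %| `|n|)%N then g n else 0) (M * l) =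
  bipart (fun n => g (n * l%:Z)) M.
Proof.
move=> l0.
(* c = 0 serves the indices n >= 0, and c = l - 1 the indices -n-1, for which l
   divides n + 1. *)
have sieve (f : nat -> R[i]) (c : nat) : (c < l)%N ->
   \sum_(0 <= n < M * l) (if (n %% l == c)%N then f n else 0) =
   \sum_(0 <= n < M) f (n * l + c)%N.
  move=> cl; elim: M => [|M' IH]; first by rewrite !big_geq.
  rewrite big_nat_recr //= -IH mulSn addnC (@big_cat_nat _ _ _ (M' * l)%N) ?leq_addr //=.
  congr (_ + _).
  rewrite -{1}[(M' * l)%N]add0n big_addn addKn big_mkord.
  rewrite (bigD1 (Ordinal cl)) //= big1 ?addr0.
    by rewrite addnC modnMDl (modn_small cl) eqxx.
  move=> i ic; rewrite addnC modnMDl modn_small // ifN //.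
rewrite /bipart !big_split /=; congr (_ + _).
  have := sieve (fun n => g n%:Z) 0%N l0.
  under [X in _ = X -> _]eq_bigr do rewrite addn0 PoszM.
  by [].
have := sieve (fun n => g (- n.+1%:Z)) l.-1.
rewrite ltn_predL => /(_ l0) H.
rewrite -[RHS](_ : \sum_(0 <= n < M) g (- (n * l + l.-1).+1%:Z) = _); last first.
  apply: eq_bigr => n _; congr g.
  by rewrite -addnS prednK // mulNr -PoszM mulSn addnC.
rewrite -H; apply: eq_bigr => n _; congr (if _ then _ else _).
rewrite /= {1}(divn_eq n l) -addnS dvdn_addr ?dvdn_mull //.
have : (n %% l <= l.-1)%N by rewrite -ltnS prednK // ltn_pmod.
rewrite leq_eqVlt => /orP[/eqP ->|rl].
  by rewrite prednK // dvdnn eqxx.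
rewrite (ltn_eqF rl); apply: gtnNdvd => //.
by rewrite -[X in (_ < X)%N](prednK l0) ltnS.
Qed.

End Polya.

Section PolyaIdentity.
Variable R : realType.
Implicit Types (s z : R[i]).

(** i (z + k pi) / l with l = 2 L. An even l lets k range over the symmetric
    interval from -L to L-1, on which the argument of the cosine stays within
    pi / 2 of 0. *)
Definition polya_arg z (L : nat) (k : int) : R[i] :=
  'i%C * (z + k%:~R * pi%:C) / (2 * L)%:R.

(** The frequency n of the binomial expansion meets the character k -> exp (2 pi
    i n k / l); only the multiples of l survive the summation over k. *)
Lemma polya_identity z m L : (0 < L)%N ->
  bipart (fun k => (cexp (polya_arg z L k) + cexp (- polya_arg z L k)) ^+ (2 * m)) L =
  (2 * L)%:R *
  bipart (fun n => 'C(2 * m, m + 2 * L * `|n|)%:R * cexp ('i%C * (2 * n)%:~R * z)) m.+1.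
Proof.
move=> L0; have l0 : (0 < 2 * L)%N by lia.
have lR : (2 * L)%:R != 0 :> R by rewrite pnatr_eq0; lia.
have lC : (2 * L)%:R != 0 :> R[i] by rewrite pnatr_eq0; lia.
have mN : (m < m.+1 * (2 * L))%N by rewrite (leq_trans (ltnSn m)) // leq_pmulr.
under eq_bipart do rewrite (cos_pow_expand _ mN).
rewrite bipart_exchange.
have split_exp (n k : int) : (2 * n)%:~R * polya_arg z L k =
    (2 * n)%:~R * ('i%C * z / (2 * L)%:R) +
    k%:~R * ('i%C * (2 * n%:~R * pi / (2 * L)%:R)%:C).
  rewrite (_ : (2 * n%:~R * pi / (2 * L)%:R)%:C = (2 * n)%:~R * pi%:C / (2 * L)%:R :> R[i]).
    by rewrite /polya_arg; move: (pi%:C) (_%:R) lC => p d d0; field.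
  by rewrite intrM !rmorphM /= fmorphV /= !rmorph_int !rmorph_nat.
have inner (n : int) : bipart (fun k => 'C(2 * m, m + `|n|)%:R *
     cexp ((2 * n)%:~R * polya_arg z L k)) L =
    (2 * L)%:R * if (2 * L %| `|n|)%N then
     'C(2 * m, m + `|n|)%:R * cexp ((2 * n)%:~R * ('i%C * z / (2 * L)%:R)) else 0.
  under eq_bipart do rewrite split_exp cexpD mulrA.
  rewrite bipart_mull bipart_root_unity //.
  by case: ifP => _; rewrite ?mulr0 // mulrC.
under eq_bipart do rewrite inner.
rewrite bipart_mull bipart_sieve //; congr (_ * _); apply: eq_bipart => n.
congr ('C(_, _)%:R * cexp _).
  by rewrite abszM /= [(2 * L * _)%N]mulnC.
have -> : (2 * (n * (2 * L)%N%:Z))%:~R = (2 * n)%:~R * (2 * L)%:R :> R[i].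
  by rewrite mulrA intrM.
by move: (_%:R) lC => d d0; field.
Qed.

End PolyaIdentity.

(** * Ratios of binomial coefficients near the centre *)

Section CentralBinomial.
Variable R : realType.

Definition binratio (m j : nat) : R := 'C(2 * m, m + j)%:R / 'C(2 * m, m)%:R.

Lemma binratio_ge0 m j : 0 <= binratio m j.
Proof. by rewrite divr_ge0. Qed.

Lemma binratio0 m : binratio m 0 = 1.
Proof. by rewrite /binratio addn0 divff // pnatr_eq0 -lt0n bin_gt0; lia. Qed.

Lemma binratioS m j :
  binratio m j.+1 = binratio m j * ((m - j)%N%:R / (m + j.+1)%:R).
Proof.
have E : (m + j.+1)%:R * 'C(2 * m, m + j.+1)%:R = (m - j)%N%:R * 'C(2 * m, m + j)%:R :> R.
  rewrite -!natrM addnS mul_bin_left; congr ((_ * _)%:R); lia.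
have n0 : (m + j.+1)%:R != 0 :> R by rewrite pnatr_eq0 addnS.
rewrite /binratio mulrAC; congr (_ / _).
by apply: (mulfI n0); rewrite E mulrCA mulrC; congr (_ * _); rewrite mulrC mulfVK.
Qed.

Lemma binratio_eq0 m j : (m < j)%N -> binratio m j = 0.
Proof. by move=> mj; rewrite /binratio bin_small ?mul0r //; lia. Qed.

(** The factor (m - j) / (m + j + 1) = 1 - (2j+1) / (m+j+1) is at most
    exp (- (2j+1) / (m+J)), and the odd numbers 2j+1 add up to j^2. The parameter
    J, an upper bound for j, keeps the denominator fixed during the induction. *)
Lemma binratio_le_shift m j J : (0 < m)%N -> (j <= J)%N ->
  binratio m j <= expR (- (j ^ 2)%:R / (m + J)%:R).
Proof.
move=> m0; elim: j => [|j IH] jJ; first by rewrite binratio0 oppr0 mul0r expR0.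
have -> : - (j.+1 ^ 2)%:R / (m + J)%:R =
    - (j ^ 2)%:R / (m + J)%:R + (- (2 * j + 1)%:R / (m + J)%:R) :> R.
  rewrite -mulrDl -opprD -natrD; congr (- _%:R / _); lia.
rewrite expRD binratioS ler_pM ?binratio_ge0 ?divr_ge0 //; first by apply: IH; lia.
case: (leqP j m) => jm; last by rewrite (_ : (m - j = 0)%N) ?mul0r ?expR_ge0 //; lia.
have n0 : (m + j.+1)%:R != 0 :> R by rewrite pnatr_eq0 addnS.
have -> : (m - j)%N%:R / (m + j.+1)%:R = 1 + - ((2 * j + 1)%:R / (m + j.+1)%:R) :> R.
  by rewrite -[X in X - _](divff n0) -mulrBl -natrB; [congr (_%:R / _); lia | lia].
rewrite (le_trans (expR_ge1Dx _)) // ler_expR mulNr lerN2 ler_wpM2l //.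
rewrite lef_pV2 ?posrE ?ltr0n ?ler_nat; lia.
Qed.

(** The same computation from below, with (m - j) / (m + j + 1) written as the
    inverse of 1 + (2j+1) / (m-j). *)
Lemma binratio_ge_shift m j J : (j <= J)%N -> (J < m)%N ->
  expR (- (j ^ 2)%:R / (m - J)%N%:R) <= binratio m j.
Proof.
move=> + Jm; elim: j => [|j IH] jJ; first by rewrite binratio0 oppr0 mul0r expR0.
have -> : - (j.+1 ^ 2)%:R / (m - J)%N%:R =
    - (j ^ 2)%:R / (m - J)%N%:R + (- (2 * j + 1)%:R / (m - J)%N%:R) :> R.
  rewrite -mulrDl -opprD -natrD; congr (- _%:R / _); lia.
rewrite expRD binratioS ler_pM ?expR_ge0 //; first by apply: IH; lia.
have mj : (0 < m - j)%N by lia.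
have mj0 : (m - j)%N%:R != 0 :> R by rewrite pnatr_eq0 -lt0n.
have -> : (m - j)%N%:R / (m + j.+1)%:R = (1 + (2 * j + 1)%:R / (m - j)%N%:R)^-1 :> R.
  rewrite -[X in X + _](divff mj0) -mulrDl -natrD invf_div; congr (_ / _%:R); lia.
rewrite mulNr expRN lef_pV2 ?posrE ?expR_gt0 ?addr_gt0 ?divr_gt0 ?ltr0n //; try lia.
rewrite (le_trans (expR_ge1Dx _)) // ler_expR ler_wpM2l //.
rewrite lef_pV2 ?posrE ?ltr0n ?ler_nat; lia.
Qed.

Lemma binratio_le m j : (0 < m)%N ->
  binratio m j <= expR (- (j ^ 2)%:R / (2 * m)%:R).
Proof.
move=> m0; case: (leqP j m) => jm; last by rewrite binratio_eq0 ?expR_ge0.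
by have := binratio_le_shift m0 jm; rewrite addnn -mul2n.
Qed.

(** De Moivre-Laplace: with j = l n both bounds above have exponents
    - n^2 / (m / l^2 +- n / l), which tend to - n^2 t. *)
Lemma cvg_binratio (l m : nat -> nat) (t : R) n : 0 < t ->
  l L @[L --> \oo] --> \oo ->
  (m L)%:R / (l L)%:R ^+ 2 @[L --> \oo] --> t^-1 ->
  binratio (m L) (l L * n) @[L --> \oo] --> expR (- (n ^ 2)%:R * t).
Proof.
move=> t0 loo mlt.
have l0 := eventually_gt0 loo.
have lV : (l L)%:R^-1 @[L --> \oo] --> (0 : R).
  by move=> A A0; apply: (cvg_invn0 loo); exact: nbhs_dnbhs.
have cp : (m L)%:R / (l L)%:R ^+ 2 + n%:R * (l L)%:R^-1 @[L --> \oo] --> t^-1.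
  rewrite -[X in _ --> X]addr0 -[X in _ + X](mulr0 n%:R).
  by apply: cvgD => //; apply: cvgM => //; exact: cvg_cst.
have cm : (m L)%:R / (l L)%:R ^+ 2 - n%:R * (l L)%:R^-1 @[L --> \oo] --> t^-1.
  rewrite -[X in _ --> X]subr0 -[X in _ - X](mulr0 n%:R).
  by apply: cvgB => //; apply: cvgM => //; exact: cvg_cst.
have tV : 0 < t^-1 by rewrite invr_gt0.
have cE (u : nat -> R) : u L @[L --> \oo] --> t^-1 ->
    expR (- (n ^ 2)%:R / u L) @[L --> \oo] --> expR (- (n ^ 2)%:R * t).
  move=> ut; apply: continuous_cvg; first exact: continuous_expR.
  apply: cvgM; first exact: cvg_cst.
  by rewrite -[X in _ --> X]invrK; apply: cvgV => //; rewrite gt_eqF.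
apply: squeeze_cvgr (cE _ cm) (cE _ cp); near=> L.
have lL : (0 < l L)%N by near: L.
have lLR : (l L)%:R != 0 :> R by rewrite pnatr_eq0 -lt0n.
have mL : (l L * n < m L)%N.
  have : 0 < (m L)%:R / (l L)%:R ^+ 2 - n%:R * (l L)%:R^-1 :> R.
    by near: L; exact: (cvgr_gt _ cm).
  rewrite subr_gt0 ltr_pdivlMr ?exprn_gt0 ?ltr0n // expr2 mulrA mulfVK //.
  by rewrite -natrM ltr_nat mulnC.
apply/andP; split.
  have := binratio_ge_shift (leqnn (l L * n)) mL.
  apply: le_trans; rewrite ler_expR natrB ?(ltnW mL) // le_eqVlt; apply/orP; left; apply/eqP.
  rewrite !natrM.
  have d0 : (m L)%:R - (l L)%:R * n%:R != 0 :> R by rewrite subr_eq0 -natrM eqr_nat; lia.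
  by field; rewrite d0 lLR.
have := @binratio_le_shift (m L) _ _ _ (leqnn (l L * n)).
move=> /(_ (leq_ltn_trans (leq0n _) mL)) /le_trans; apply.
rewrite ler_expR le_eqVlt; apply/orP; left; apply/eqP.
rewrite !natrD !natrM.
have d0 : (m L)%:R + (l L)%:R * n%:R != 0 :> R by rewrite -natrM -natrD pnatr_eq0; lia.
by field; rewrite lLR [n%:R * _]mulrC d0.
Unshelve. all: by end_near. Qed.

End CentralBinomial.

(** * Powers of the cosine: limit and domination *)

Section CosPowers.
Variable R : realType.

(** sin b = 2 sin (b/2) cos (b/2), where sin (b/2) >= (b/2) cos (pi/4) by the
    mean value theorem, cos (b/2) >= cos (pi/4), and cos (pi/4)^2 = 1/2. *)
Lemma sin_ge_half (b : R) : 0 <= b <= pi / 2 -> b / 2 <= sin b.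
Proof.
move=> /andP[b0 bpi]; have pi0 := pi_gt0 R.
pose c : R := cos (pi / 4).
have c0 : 0 <= c by apply: cos_ge0_pihalf; apply/andP; split; lra.
have c2 : c * c = 2^-1.
  have := cos_mulr2n (pi / 4 : R).
  rewrite (_ : pi / 4 *+ 2 = pi / 2); last by rewrite mulr2n; lra.
  rewrite cos_pihalf -/c expr2 mulr2n => ?; lra.
have cosc (x : R) : 0 <= x <= pi / 4 -> c <= cos x.
  move=> /andP[x0 x4]; rewrite leNgt; apply/negP; rewrite ltr_cos ?in_itv /=.
  - by move=> ?; lra.
  - by apply/andP; split; lra.
  - by apply/andP; split; lra.
have sb : b / 2 * c <= sin (b / 2).
  have [->|bn0] := eqVneq b 0; first by rewrite !mul0r sin0.
  have b20 : 0 < b / 2 by rewrite divr_gt0 // lt_neqAle eq_sym bn0.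
  have [x] := @MVT R sin cos 0 (b / 2) b20 (fun x _ => is_derive_sin x)
     (continuous_subspaceT (@continuous_sin R)).
  rewrite in_itv /= sin0 !subr0 => /andP[x0 xb] ->.
  rewrite mulrC ler_wpM2r ?(ltW b20) //; apply: cosc; apply/andP; split; lra.
have -> : sin b = 2 * (cos (b / 2) * sin (b / 2)).
  have := sin_mulr2n (b / 2); rewrite (_ : b / 2 *+ 2 = b); last by rewrite mulr2n; lra.
  by move=> ->; rewrite mulr_natl.
have cb : c <= cos (b / 2) by apply: cosc; apply/andP; split; lra.
have : c * (b / 2 * c) <= cos (b / 2) * sin (b / 2).
  by apply: ler_pM => //; rewrite mulr_ge0 //; lra.
rewrite mulrCA c2 => ?; lra.
Qed.

Lemma sin_sqr_ge (b : R) : `|b| <= pi / 2 -> b ^+ 2 / 4 <= sin b ^+ 2.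
Proof.
move=> bpi.
have H (x : R) : 0 <= x <= pi / 2 -> x ^+ 2 / 4 <= sin x ^+ 2.
  move=> /[dup] /andP[x0 _] /sin_ge_half sx.
  by rewrite (_ : x ^+ 2 / 4 = (x / 2) ^+ 2) ?lerXn2r ?nnegrE ?divr_ge0 //;
    [rewrite (le_trans _ sx) ?divr_ge0 | field].
have [b0|b0] := leP 0 b; first by apply: H; rewrite b0 -(ger0_norm b0).
have := H (- b); rewrite sinN !sqrrN; apply.
by rewrite oppr_ge0 (ltW b0) -(ltr0_norm b0).
Qed.

Lemma sinh_sqr_le (a : R) : ((expR a - expR (- a)) / 2) ^+ 2 <= a ^+ 2 * expR (2 * `|a|).
Proof.
have H (x : R) : 0 <= x -> ((expR x - expR (- x)) / 2) ^+ 2 <= x ^+ 2 * expR (2 * x).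
  move=> x0.
  have E : expR (2 * x) = expR x ^+ 2 by rewrite -expRM_natl mulr_natl.
  have E2 : expR x * expR (- x) = 1 by rewrite -expRD subrr expR0.
  have E3 : expR (- x) = expR x * expR (- 2 * x) by rewrite -expRD; congr expR; ring.
  rewrite E -exprMn lerXn2r ?nnegrE ?mulr_ge0 ?expR_ge0 ?divr_ge0 //.
    by rewrite subr_ge0 ler_expR; lra.
  rewrite E3 -{1}[expR x]mulr1 -mulrBr -mulrA mulrC ler_wpM2r ?expR_ge0 //.
  have := expR_ge1Dx (- 2 * x); lra.
have [a0|a0] := leP 0 a; first by rewrite (ger0_norm a0); exact: H.
have := H (- a); rewrite opprK (ltr0_norm a0) sqrrN.
rewrite (_ : (expR (- a) - expR a) / 2 = - ((expR a - expR (- a)) / 2)); last by ring.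
by rewrite sqrrN; apply; lra.
Qed.

(** For w = a + i b the square of the modulus of cosh w is
    1 + sinh^2 a - sin^2 b, and 1 + x <= exp x. *)
Lemma cabs_cosh_sqr_le (w : R[i]) : `|complex.Im w| <= pi / 2 ->
  cabs ((cexp w + cexp (- w)) / 2) ^+ 2 <=
  expR (complex.Re w ^+ 2 * expR (2 * `|complex.Re w|) - complex.Im w ^+ 2 / 4).
Proof.
case: w => a b /= hb.
have -> : cabs ((cexp (a +i* b) + cexp (- (a +i* b))) / 2) ^+ 2 =
   1 + (((expR a - expR (- a)) / 2) ^+ 2 - sin b ^+ 2).
  rewrite -(rmorph_nat (real_complex R) 2).
  set c := _ / _.
  have Rc : complex.Re c = (expR a + expR (- a)) / 2 * cos b.
    by rewrite /c Re_divC /= cosN; ring.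
  have Ic : complex.Im c = (expR a - expR (- a)) / 2 * sin b.
    by rewrite /c Im_divC /= sinN; ring.
  have -> : cabs c ^+ 2 = complex.Re c ^+ 2 + complex.Im c ^+ 2.
    by case: (c) => p q /=; rewrite sqr_sqrtr // addr_ge0 ?sqr_ge0.
  rewrite Rc Ic !exprMn cos2sin2.
  have E : expR a * expR (- a) = 1 by rewrite -expRD subrr expR0.
  rewrite (_ : (expR a + expR (- a)) ^+ 2 = (expR a - expR (- a)) ^+ 2 + 4 * (expR a * expR (- a))); last by ring.
  by rewrite E; field.
rewrite (le_trans (expR_ge1Dx _)) // ler_expR lerB //; first exact: sinh_sqr_le.
exact: sin_sqr_ge.
Qed.

(** cosh^2 (u/l) = 1 + sinh^2 (u/l), and l sinh (u/l) -> u. *)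
Lemma cvg_cosh_pow (u : R[i]) (l m : nat -> nat) (t : R) : 0 < t ->
  l L @[L --> \oo] --> \oo -> m L @[L --> \oo] --> \oo ->
  (m L)%:R / (l L)%:R ^+ 2 @[L --> \oo] --> t^-1 ->
  ((fun L => (((cexp (u / (l L)%:R) + cexp (- (u / (l L)%:R))) / 2) ^+ 2) ^+ m L)
     : nat -> R[i]^o) @ \oo --> (cexp (u ^+ 2 / t%:C) : R[i]^o).
Proof.
move=> t0 loo moo mlt.
have h0 := @cvg_invn0 R _ loo.
have slope (v : R[i]) : ((fun L => (cexp ((l L)%:R^-1%:C * v) - 1) / (l L)%:R^-1%:C) : nat -> R[i]^o)
    @ \oo --> (v : R[i]^o) by exact: cvg_cexp_slope.
(* w L is l sinh (u / l), the mean of the difference quotients at u and - u. *)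
pose w L := ((cexp ((l L)%:R^-1%:C * u) - 1) / (l L)%:R^-1%:C -
             (cexp ((l L)%:R^-1%:C * - u) - 1) / (l L)%:R^-1%:C) / 2.
have cw : (w : nat -> R[i]^o) @ \oo --> (u : R[i]^o).
  rewrite [X in _ --> X](_ : u = (u - - u) / 2); last by field.
  apply: cvgM; last exact: cvg_cst.
  exact: (cvgB (slope u) (slope (- u))).
pose c L := ((m L)%:R / (l L)%:R ^+ 2 : R)%:C * (w L * w L).
have cc : (c : nat -> R[i]^o) @ \oo --> (u ^+ 2 / t%:C : R[i]^o).
  rewrite [X in _ --> X](_ : _ = (t^-1)%:C * (u * u)); last first.
    by rewrite fmorphV mulrC expr2.
  by apply: cvgM; [exact: cvgC_real | exact: cvgM].
apply: cvg_trans (cvg_expr_cexp moo cc); apply: near_eq_cvg.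
near=> L.
have lL : (0 < l L)%N by near: L; exact: eventually_gt0.
have mL : (0 < m L)%N by near: L; exact: eventually_gt0.
have mC : (m L)%:R != 0 :> R[i] by rewrite pnatr_eq0 -lt0n.
have lC : (l L)%:R != 0 :> R[i] by rewrite pnatr_eq0 -lt0n.
congr (_ ^+ m L).
rewrite /c /w rmorphM /= fmorphV rmorphXn /= !rmorph_nat fmorphV rmorph_nat.
rewrite mulrN ![_^-1 * u]mulrC.
have := cexpNK (u / (l L)%:R).
move: (cexp _) (cexp _) => E E' EE.
rewrite -[X in X + _]EE.
by field; rewrite mC lC.
Unshelve. all: by end_near. Qed.

End CosPowers.

(** * The two sides of the finite identity in the limit *)

Definition polya_l (L : nat) : nat := 2 * L.+1.

Lemma cvg_polya_l : polya_l L @[L --> \oo] --> \oo.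
Proof.
apply/cvgnyPge => A; exists A => // L /= AL; rewrite /polya_l; lia.
Qed.

Section PolyaSequence.
Variable R : realType.
Variable t : R.
Hypothesis t0 : 0 < t.

(** The largest m with m / l^2 <= 1 / t. *)
Definition polya_m (L : nat) : nat := Num.truncn ((polya_l L)%:R ^+ 2 / t).

Lemma polya_l_gt0 L : 0 < (polya_l L)%:R :> R.
Proof. by rewrite ltr0n. Qed.

Lemma polya_m_le L : (polya_m L)%:R / (polya_l L)%:R ^+ 2 <= t^-1.
Proof.
have l0 := polya_l_gt0 L.
rewrite ler_pdivrMr ?exprn_gt0 // mulrC.
by rewrite truncn_le divr_ge0 ?exprn_ge0 ?ltW.
Qed.

Lemma polya_m_ge L : t^-1 - (polya_l L)%:R^-1 * (polya_l L)%:R^-1 <=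
  (polya_m L)%:R / (polya_l L)%:R ^+ 2.
Proof.
have l0 := polya_l_gt0 L.
rewrite ler_pdivlMr ?exprn_gt0 //.
have -> : (t^-1 - (polya_l L)%:R^-1 * (polya_l L)%:R^-1) * (polya_l L)%:R ^+ 2 =
    (polya_l L)%:R ^+ 2 / t - 1.
  by move: (_%:R) l0 => d d0; field; rewrite !gt_eqF.
by rewrite lerBlDr natr1; apply: ltW; exact: truncnS_gt.
Qed.

Lemma cvg_polya_ratio :
  (polya_m L)%:R / (polya_l L)%:R ^+ 2 @[L --> \oo] --> t^-1.
Proof.
have lV : (polya_l L)%:R^-1 @[L --> \oo] --> (0 : R).
  by move=> A A0; apply: (cvg_invn0 cvg_polya_l); exact: nbhs_dnbhs.
have lo : t^-1 - (polya_l L)%:R^-1 * (polya_l L)%:R^-1 @[L --> \oo] --> t^-1.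
  rewrite -[X in _ --> X]subr0 -[X in _ - X](mulr0 (0 : R)).
  by apply: cvgB; [exact: cvg_cst | exact: cvgM].
apply: squeeze_cvgr lo (cvg_cst _).
by near=> L; rewrite polya_m_ge polya_m_le.
Unshelve. all: by end_near. Qed.

Lemma cvg_polya_m : polya_m L @[L --> \oo] --> \oo.
Proof.
apply/cvgnyPge => A.
exists (Num.truncn (A%:R * t)).+1 => // L /= AL.
have l0 := polya_l_gt0 L.
rewrite /polya_m -(natrK (R := R) A); apply: le_truncn.
rewrite ler_pdivlMr //.
have h1 : A%:R * t < (polya_l L)%:R.
  rewrite (lt_le_trans (truncnS_gt _)) // ler_nat; apply: (leq_trans AL).
  by rewrite /polya_l; lia.
rewrite (le_trans (ltW h1)) // expr2 ler_peMr ?ltW // ltr1n /polya_l; lia.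
Qed.

End PolyaSequence.

Section Transformation.
Variable R : realType.
Implicit Types (z : R[i]) (t x : R).

Definition gauss_term z t (k : int) : R[i] :=
  cexp (- (z + k%:~R * pi%:C) ^+ 2 / t%:C).

Definition theta3_term z t (n : int) : R[i] :=
  (expR (- (n%:~R ^+ 2 * t)))%:C * cexp ('i%C * (2 * n)%:~R * z).

Lemma sqr_shift_ge x n : 0 <= x <= pi ->
  n%:R <= (x + n%:Z%:~R * pi) ^+ 2 /\ n%:R <= (x + (- n.+1%:Z)%:~R * pi) ^+ 2.
Proof.
move=> /andP[x0 xpi]; have pi1 : 1 <= pi :> R by rewrite (le_trans _ (pi_ge2 R)) ?ler1n.
have nn : n%:R <= n%:R ^+ 2 :> R by rewrite -natrX ler_nat; case: n => // n; nia.
have npi : n%:R <= n%:R * pi :> R by rewrite ler_peMr.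
have n0 : 0 <= n%:R :> R by [].
split; apply: (le_trans nn); rewrite -?pmulrn.
  by rewrite lerXn2r ?nnegrE ?addr_ge0 ?(le_trans n0 npi) // ler_wpDl.
rewrite intrN mulNr -[_%:~R]/(n.+1%:R) -natr1 mulrDl mul1r -[leRHS]sqrrN.
by rewrite lerXn2r ?nnegrE //; lra.
Qed.

Lemma Re_polya_arg z L k : complex.Re (polya_arg z L k) = - complex.Im z / (2 * L)%:R.
Proof.
rewrite /polya_arg -(rmorph_nat (real_complex R)) Re_divC; congr (_ / _).
case: z => a b; rewrite -(rmorph_int (real_complex R)) -rmorphM /=.
by ring.
Qed.

Lemma Im_polya_arg z L k :
  complex.Im (polya_arg z L k) = (complex.Re z + k%:~R * pi) / (2 * L)%:R.
Proof.
rewrite /polya_arg -(rmorph_nat (real_complex R)) Im_divC; congr (_ / _).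
case: z => a b; rewrite -(rmorph_int (real_complex R)) -rmorphM /=.
by ring.
Qed.

(** The modulus is that of cosh^(2m) at - y/l + i (x + k pi)/l, for z = x + i y.
    The range of k keeps the imaginary part within pi / 2, so cabs_cosh_sqr_le
    applies; the two bounds on m / l^2 turn it into a bound free of m and l. *)
Lemma cabs_polya_summand_le z t L m k : 0 < t -> (0 < L)%N -> 0 <= complex.Re z <= pi ->
  - L%:Z <= k < L%:Z -> m%:R / (2 * L)%:R ^+ 2 <= t^-1 ->
  (2 * t)^-1 <= m%:R / (2 * L)%:R ^+ 2 ->
  cabs ((((cexp (polya_arg z L k) + cexp (- polya_arg z L k)) / 2) ^+ 2) ^+ m) <=
  expR (complex.Im z ^+ 2 * expR (2 * `|complex.Im z|) / t) *
  expR (- (complex.Re z + k%:~R * pi) ^+ 2 / (8 * t)).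
Proof.
move=> t0 L0 /andP[x0 xpi] /andP[kL Lk] ml1 ml2.
have l0 : 0 < (2 * L)%:R :> R by rewrite ltr0n; lia.
have l1 : 1 <= (2 * L)%:R :> R by rewrite ler1n; lia.
have pi0 := pi_gt0 R.
have hb : `|complex.Im (polya_arg z L k)| <= pi / 2.
  rewrite Im_polya_arg normrM normfV (gtr0_norm l0) ler_pdivrMr //.
  rewrite natrM mulrA mulfVK // ler_norml.
  have k1 : k%:~R <= L%:R - 1 :> R by rewrite lerBrDr -(intrD _ k 1) -[L%:R]/(L%:Z%:~R) ler_int; lia.
  have k2 : - L%:R <= k%:~R :> R by rewrite -[L%:R]/(L%:Z%:~R) -intrN ler_int.
  apply/andP; split; nra.
rewrite !cabsX -exprM; rewrite exprM.
apply: le_trans (_ : expR _ ^+ m <= _).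
  by rewrite lerXn2r ?nnegrE ?exprn_ge0 ?cabs_ge0 ?expR_ge0 //; exact: cabs_cosh_sqr_le.
rewrite -expRM_natl -expRD ler_expR Re_polya_arg Im_polya_arg.
set y := complex.Im z; set x := complex.Re z + _; set l : R := (2 * L)%:R in l0 l1 ml1 ml2 *.
have e1 : expR (2 * `|- y / l|) <= expR (2 * `|y|).
  rewrite ler_expR ler_wpM2l // normrM normrN normfV (gtr0_norm l0).
  by rewrite ler_pdivrMr // ler_peMr.
have l2 : 0 < l ^+ 2 by rewrite exprn_gt0.
have resc (a c e : R) : a * ((- c / l) ^+ 2 * e) = a / l ^+ 2 * (c ^+ 2 * e).
  by move: (l) l0 => d d0; field; rewrite gt_eqF.
rewrite mulrBr lerD //.
  have -> : m%:R * ((- y / l) ^+ 2 * expR (2 * `|- y / l|)) =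
     (m%:R / l ^+ 2) * (y ^+ 2 * expR (2 * `|- y / l|)).
    exact: resc.
  rewrite [leRHS]mulrC; apply: ler_pM => //.
  - by rewrite divr_ge0 // ltW.
  - by apply: mulr_ge0; [exact: sqr_ge0 | exact: expR_ge0].
  - by apply: ler_wpM2l => //; exact: sqr_ge0.
rewrite mulNr lerN2.
have -> : m%:R * ((x / l) ^+ 2 / 4) = (m%:R / l ^+ 2) * (x ^+ 2 / 4).
  by rewrite -[in LHS](opprK x); rewrite resc sqrrN.
have -> : x ^+ 2 / (8 * t) = (2 * t)^-1 * (x ^+ 2 / 4).
  by field; rewrite gt_eqF.
by rewrite ler_wpM2r // divr_ge0 ?sqr_ge0.
Qed.

Lemma cabs_theta3_exp z (n : int) :
  cabs (cexp ('i%C * (2 * n)%:~R * z)) <= expR (2 * `|n|%N%:R * `|complex.Im z|).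
Proof.
rewrite cabs_cexp ler_expR.
have -> : complex.Re ('i%C * (2 * n)%:~R * z) = - ((2 * n)%:~R * complex.Im z).
  rewrite -(rmorph_int (real_complex R)); case: z => a b /=; ring.
rewrite (le_trans (ler_norm _)) // normrN normrM intrM normrM.
by rewrite [`|2%:~R|]ger0_norm // natr_absz intr_norm.
Qed.

(** Completing the square in N. *)
Lemma quadratic_dominates (a y N : R) : 0 < a ->
  - (N ^+ 2 * a) + 2 * N * y <= (2 * y + 1) ^+ 2 / (4 * a) - N.
Proof.
move=> a0; rewrite -subr_ge0.
have -> : (2 * y + 1) ^+ 2 / (4 * a) - N - (- (N ^+ 2 * a) + 2 * N * y) =
  (2 * a * N - (2 * y + 1)) ^+ 2 / (4 * a) by field; rewrite gt_eqF.
by rewrite divr_ge0 ?sqr_ge0 // mulr_ge0 // ltW.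
Qed.

Lemma gauss_geometric t x n : 0 < t -> 0 <= x <= pi ->
  let r := expR (- (8 * t)^-1) in
  expR (- (x + n%:Z%:~R * pi) ^+ 2 / (8 * t)) <= r ^+ n /\
  expR (- (x + (- n.+1%:Z)%:~R * pi) ^+ 2 / (8 * t)) <= r ^+ n.
Proof.
move=> t0 x0 r; have [h1 h2] := sqr_shift_ge n x0.
have t8 : 0 <= (8 * t)^-1 by rewrite invr_ge0 mulr_ge0 // ltW.
by split; rewrite /r -expRM_natl ler_expR mulrN mulNr lerN2; exact: ler_wpM2r.
Qed.

Lemma cvg_polya_gauss z t : 0 < t -> 0 <= complex.Re z <= pi ->
  ((fun L => bipart (fun k => (((cexp (polya_arg z L.+1 k) +
     cexp (- polya_arg z L.+1 k)) / 2) ^+ 2) ^+ polya_m t L) L.+1)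
   : nat -> R[i]^o) @ \oo --> (bisum (gauss_term z t) : R[i]^o).
Proof.
move=> t0 zpi.
pose C := expR (complex.Im z ^+ 2 * expR (2 * `|complex.Im z|) / t).
apply: (@bisum_tannery _ (fun L k => _) _ C (expR (- (8 * t)^-1)) succn).
- move=> k.
  have := cvg_cosh_pow (u := 'i%C * (z + k%:~R * pi%:C)) t0 (cvg_polya_l) (cvg_polya_m t0) (cvg_polya_ratio t0).
  rewrite exprMn sqr_i mulN1r; exact.
- by rewrite expR_ge0 /= -expR0 ltr_expR oppr_lt0 invr_gt0 mulr_gt0.
- have tt : (2 * t)^-1 < t^-1 by rewrite ltf_pV2 ?posrE ?mulr_gt0 //; lra.
  have ev := cvgr_gt _ (cvg_polya_ratio t0) _ tt.
  near=> L => n nL.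
  have mL : (2 * t)^-1 <= (polya_m t L)%:R / (2 * L.+1)%:R ^+ 2.
    by apply: ltW; near: L; exact: ev.
  have [g1 g2] := gauss_geometric n t0 zpi.
  split; (apply: le_trans (cabs_polya_summand_le t0 (ltn0Sn L) zpi _ (polya_m_le t0 L) mL) _; first by lia);
    by rewrite ler_wpM2l ?expR_ge0.
- by apply/cvgnyPge => A; exists A => // n /= ?; lia.
Unshelve. all: by end_near. Qed.

Lemma cvg_polya_theta z t : 0 < t ->
  ((fun L => bipart (fun n => (binratio R (polya_m t L) (polya_l L * `|n|))%:C *
     cexp ('i%C * (2 * n)%:~R * z)) (polya_m t L).+1)
   : nat -> R[i]^o) @ \oo --> (bisum (theta3_term z t) : R[i]^o).
Proof.
move=> t0.
set y := `|complex.Im z|.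
(* m <= l^2 / t bounds the binomial ratio by exp (- n^2 t / 2), and
   quadratic_dominates with a = t / 2 absorbs the growth exp (2 n y). *)
pose C := expR ((2 * y + 1) ^+ 2 / (4 * (t / 2))).
have dom L (n : int) : (0 < polya_m t L)%N ->
    cabs ((binratio R (polya_m t L) (polya_l L * `|n|))%:C *
     cexp ('i%C * (2 * n)%:~R * z)) <= C * expR (- 1) ^+ `|n|.
  move=> m0.
  rewrite cabsM cabsC ger0_norm ?binratio_ge0 // /C -expRM_natl -expRD.
  apply: le_trans (ler_pM (binratio_ge0 _ _ _) (cabs_ge0 _)
    (binratio_le _ _ m0) (cabs_theta3_exp z n)) _.
  rewrite -expRD ler_expR mulrN1.
  set N : R := `|n|%N%:R.
  have h2 : - (((polya_l L * `|n|) ^ 2)%N%:R) / (2 * polya_m t L)%N%:R <= - (N ^+ 2 * (t / 2)).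
    rewrite mulNr lerN2.
    have mR : 0 < (polya_m t L)%:R :> R by rewrite ltr0n.
    have ml := polya_m_le t0 L.
    rewrite natrX natrM natrM -/N ler_pdivlMr ?mulr_gt0 //.
    rewrite ler_pdivrMr ?exprn_gt0 ?polya_l_gt0 // in ml.
    rewrite ler_pdivlMl // in ml.
    rewrite exprMn.
    have N2 : 0 <= N ^+ 2 by rewrite sqr_ge0.
    rewrite (_ : _ * (2 * _) = t * (polya_m t L)%:R * N ^+ 2); last by field.
    exact: ler_wpM2r.
  apply: le_trans (lerD h2 (lexx _)) _.
  by apply: quadratic_dominates; rewrite divr_gt0.
apply: (@bisum_tannery _ (fun L k => _) _ C (expR (- 1)) (fun L => (polya_m t L).+1)).
- move=> n; apply: cvgM; last exact: cvg_cst.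
  apply: cvgC_real.
  have := cvg_binratio (n := `|n|%N) t0 (cvg_polya_l) (cvg_polya_ratio t0).
  by rewrite natrX natr_absz mulNr intr_norm real_normK ?num_real.
- by rewrite expR_ge0 /= -expR0 ltr_expR.
- apply: filterS (eventually_gt0 (cvg_polya_m t0)) => L m0 n _; split; first exact: dom.
  apply: le_trans (dom L _ m0) _.
  rewrite abszN /= ler_wpM2l ?expR_ge0 // exprSr ler_piMr ?exprn_ge0 ?expR_ge0 //.
- apply/cvgnyPge => A; move/cvgnyPge : (cvg_polya_m t0) => /(_ A).
  apply: filterS => L; lia.
Qed.

End Transformation.

(** * The constant *)

Section Wallis.
Variable R : realType.

(** The square of 4^n / (sqrt n binom (2n, n)). *)
Definition wallis (n : nat) : R := 16 ^+ n / (n%:R * 'C(2 * n, n)%:R ^+ 2).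

Lemma central_binS n : (n.+1 * 'C(2 * n.+1, n.+1) = 2 * (2 * n + 1) * 'C(2 * n, n))%N.
Proof.
have -> : (2 * n.+1 = (2 * n).+2)%N by lia.
rewrite binS.
have -> : 'C((2 * n).+1, n) = 'C((2 * n).+1, n.+1).
  by rewrite -bin_sub; [congr 'C(_, _); lia | lia].
have := mul_bin_diag (2 * n).+1 n; rewrite /= => H; nia.
Qed.

(** The quotient of consecutive terms is 4 n (n+1) / (2n+1)^2 <= 1. *)
Lemma wallis_cvg : cvgn wallis.
Proof.
suff : cvgn (fun n => wallis n.+1).
  move=> /cvg_ex[l lw]; apply/cvg_ex; exists l.
  by rewrite -cvg_shiftS.
apply: nonincreasing_is_cvgn; last first.
  exists 0 => _ [n _ <-]; rewrite divr_ge0 ?exprn_ge0 ?mulr_ge0 // exprn_ge0 //.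
apply/nonincreasing_seqP => n.
rewrite /wallis.
set N := n.+1.
have N0 : 0 < N%:R :> R by rewrite ltr0n.
have b0 : 0 < 'C(2 * N, N)%:R :> R by rewrite ltr0n bin_gt0; lia.
have b1 : 0 < 'C(2 * N.+1, N.+1)%:R :> R by rewrite ltr0n bin_gt0; lia.
have E : (N%:R + 1) * 'C(2 * N.+1, N.+1)%:R = 2 * (2 * N%:R + 1) * 'C(2 * N, N)%:R :> R.
  by rewrite natr1 -natrM central_binS !natrM natrD natrM.
have N1 : 0 < N%:R + 1 :> R by rewrite ltr_wpDl.
have -> : 'C(2 * N.+1, N.+1)%:R = 2 * (2 * N%:R + 1) * 'C(2 * N, N)%:R / (N%:R + 1) :> R.
  by rewrite -E mulrAC mulfV ?mul1r // gt_eqF.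
rewrite -[N.+1%:R]natr1 [16 ^+ N.+1]exprS.
move: N%:R N0 N1 ('C(2 * N, N)%:R) b0 {E b1} => x x0 x1 b b0.
have p0 : 0 < 16 ^+ N :> R by rewrite exprn_gt0.
move: (16 ^+ N) p0 => p p0.
have d0 : 0 < 2 * x + 1 by rewrite addr_gt0 // mulr_gt0.
rewrite (_ : 16 * p / _ = p / (x * b ^+ 2) * (4 * x * (x + 1) / (2 * x + 1) ^+ 2)); last first.
  by field; rewrite !gt_eqF.
apply: ler_piMr.
  by apply: divr_ge0; [exact: ltW | apply: mulr_ge0; [exact: ltW | exact: sqr_ge0]].
rewrite ler_pdivrMr ?exprn_gt0 // mul1r; nra.
Qed.

End Wallis.

Section Jacobi.
Variable R : realType.
Implicit Types (z : R[i]) (t x : R).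

(** Polya's identity divided by l binom (2m, m); the factor left on the side of
    the cosines is 4^m / (l binom (2m, m)), written through its square. *)
Lemma polya_scaled z t L : 0 < t -> (0 < polya_m t L)%N ->
  (Num.sqrt (wallis R (polya_m t L) * ((polya_m t L)%:R / (polya_l L)%:R ^+ 2)))%:C *
  bipart (fun k => (((cexp (polya_arg z L.+1 k) +
     cexp (- polya_arg z L.+1 k)) / 2) ^+ 2) ^+ polya_m t L) L.+1 =
  bipart (fun n => (binratio R (polya_m t L) (polya_l L * `|n|))%:C *
     cexp ('i%C * (2 * n)%:~R * z)) (polya_m t L).+1.
Proof.
move=> t0; set m := polya_m t L => m0.
have l0 := polya_l_gt0 R L.
have b0 : 0 < 'C(2 * m, m)%:R :> R by rewrite ltr0n bin_gt0; lia.
have m0R : 0 < m%:R :> R by rewrite ltr0n.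
pose K : R := 4 ^+ m / ((polya_l L)%:R * 'C(2 * m, m)%:R).
have K0 : 0 <= K by rewrite divr_ge0 ?exprn_ge0 // mulr_ge0.
have -> : Num.sqrt (wallis R m * (m%:R / (polya_l L)%:R ^+ 2)) = K.
  rewrite -[RHS]ger0_norm // -sqrtr_sqr; congr Num.sqrt.
  have -> : K ^+ 2 = 16 ^+ m / ((polya_l L)%:R * 'C(2 * m, m)%:R) ^+ 2.
    by rewrite /K expr_div_n -[_ ^+ m ^+ 2]exprM [in 4 ^+ _]mulnC exprM -natrX.
  rewrite /wallis.
  move: (16 ^+ m) => p; move: (polya_l L)%:R l0 m%:R m0R ('C(_, _)%:R) b0 => l l0 x x0 b b0.
  by field; rewrite !gt_eqF.
have := polya_identity z m (ltn0Sn L); rewrite -/(polya_l L) => PI.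
have e1 : bipart (fun k => (cexp (polya_arg z L.+1 k) + cexp (- polya_arg z L.+1 k)) ^+ (2 * m)) L.+1
   = 4 ^+ m * bipart (fun k => (((cexp (polya_arg z L.+1 k) +
     cexp (- polya_arg z L.+1 k)) / 2) ^+ 2) ^+ m) L.+1.
  rewrite -bipart_mull; apply: eq_bipart => k.
  by rewrite -exprMn exprM; congr (_ ^+ m); field.
have e2 : bipart (fun n => 'C(2 * m, m + polya_l L * `|n|)%:R * cexp ('i%C * (2 * n)%:~R * z)) m.+1
   = ('C(2 * m, m)%:R)%:C * bipart (fun n => (binratio R m (polya_l L * `|n|))%:C *
     cexp ('i%C * (2 * n)%:~R * z)) m.+1.
  rewrite -bipart_mull; apply: eq_bipart => k.
  rewrite mulrA -rmorphM /= /binratio mulrC [X in X%:C]mulrC mulfVK ?gt_eqF // rmorph_nat.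
  by rewrite mulrC.
rewrite e1 e2 in PI.
have c0 : ('C(2 * m, m)%:R)%:C != 0 :> R[i] by rewrite rmorph_nat pnatr_eq0 -lt0n bin_gt0; lia.
have l1 : (polya_l L)%:R != 0 :> R[i] by rewrite pnatr_eq0.
rewrite /K rmorphM fmorphV rmorphM rmorphXn /= [(4%:R)%:C]rmorph_nat [((polya_l L)%:R)%:C]rmorph_nat.
rewrite mulrAC PI.
by move: (bipart _ _) (_%:C) c0 (_%:R) l1 => B c c0 l l0'; field; rewrite c0 l0'.
Qed.

Lemma theta3_gauss_wallis z t : 0 < t -> 0 <= complex.Re z <= pi ->
  bisum (theta3_term z t) = (Num.sqrt (limn (wallis R) / t))%:C * bisum (gauss_term z t).
Proof.
move=> t0 zpi.
have c1 := cvg_polya_theta (z := z) t0.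
have c2 := cvg_polya_gauss t0 zpi.
have cK : (Num.sqrt (wallis R (polya_m t L) * ((polya_m t L)%:R / (polya_l L)%:R ^+ 2)))
   @[L --> \oo] --> Num.sqrt (limn (wallis R) / t).
  apply: continuous_cvg; first exact: sqrt_continuous.
  apply: cvgM; last exact: cvg_polya_ratio.
  exact: (cvg_comp _ _ (cvg_polya_m t0) (@wallis_cvg R)).
have /cvgC_real cKC := cK.
have c3 := @cvgM _ _ _ eventually_filter _ _ _ _ cKC c2.
apply: (cvg_unique _ c1); first exact: norm_hausdorff.
apply: cvg_trans c3; apply: near_eq_cvg.
by apply: filterS (eventually_gt0 (cvg_polya_m t0)) => L m0; exact: polya_scaled.
Qed.

(** At z = 0 the approximants are real, with nonnegative terms and central term
    1. *)
Lemma theta3_at0_neq0 t : 0 < t -> bisum (theta3_term 0 t) != 0.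
Proof.
move=> t0; have /cvgC_Re c1 := cvg_polya_theta (z := (0 : R[i])) t0.
suff : 1 <= complex.Re (bisum (theta3_term 0 t)).
  by apply: contraTneq => ->; rewrite /= ler10.
apply: (cvgr_to_ge c1); near=> L.
rewrite (@eq_bipart _ _ (fun n => (binratio R (polya_m t L) (polya_l L * `|n|))%:C)); last first.
  by move=> n; rewrite mulr0 cexp0 mulr1.
rewrite /bipart big_nat_recl // raddfD /= muln0 binratio0 -addrA lerDl.
apply: addr_ge0; first exact: binratio_ge0.
rewrite (big_morph (@complex.Re R) (id1 := 0) (op1 := +%R)) //; last by case=> ? ? [].
by apply: sumr_ge0 => n _; apply: addr_ge0; exact: binratio_ge0.
Unshelve. all: by end_near. Qed.

(** t = pi, z = 0 is a fixed point of the transformation: n^2 t = (n pi)^2 / t. *)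
Lemma wallis_lim : limn (wallis R) = pi.
Proof.
have pi0 := pi_gt0 R.
have z0 : 0 <= complex.Re (0 : R[i]) <= pi by rewrite /= lexx ltW.
have := theta3_gauss_wallis pi0 z0.
have -> : gauss_term (0 : R[i]) pi = theta3_term 0 pi.
  apply/funext => n; rewrite /gauss_term /theta3_term mulr0 cexp0 mulr1 add0r -cexp_real.
  congr cexp; rewrite rmorphN rmorphM rmorphXn /= rmorph_int.
  by move: (pi%:C) (realC_neq0 pi0) => p p0; field.
move=> /(congr1 (fun s => s / bisum (theta3_term 0 pi))).
have nz := theta3_at0_neq0 pi0.
rewrite divff // mulfK // => /complexI /esym H.
have V0 : 0 <= limn (wallis R) / pi.
  apply: divr_ge0; last exact: ltW.
  apply: limr_ge; first exact: wallis_cvg.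
  by near=> n; rewrite divr_ge0 ?exprn_ge0 ?mulr_ge0 ?exprn_ge0.
have : limn (wallis R) / pi = 1 by rewrite -(sqr_sqrtr V0) H expr1n.
by move=> /(congr1 ( *%R^~ pi)); rewrite mulfVK ?gt_eqF // mul1r.
Unshelve. all: by end_near. Qed.

(** Jacobi's imaginary transformation of theta3, on a strip that contains a
    representative of every z modulo pi. *)
Theorem jacobi_identity z t : 0 < t -> 0 <= complex.Re z <= pi ->
  bisum (theta3_term z t) = (Num.sqrt (pi / t))%:C * bisum (gauss_term z t).
Proof. by move=> t0 zpi; rewrite theta3_gauss_wallis // wallis_lim. Qed.

End Jacobi.

(** * Bilateral series dominated by their leading pair *)

Section Bisum.
Variable R : realType.
Implicit Types (u v : int -> R[i]) (C r : R).

Definition geom_bounded C r u := 0 <= r < 1 /\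
  forall n : nat, cabs (u n%:Z) <= C * r ^+ n /\ cabs (u (- n.+1%:Z)) <= C * r ^+ n.

Lemma cvg_bipart C r u : geom_bounded C r u ->
  (bipart u : nat -> R[i]^o) @ \oo --> (bisum u : R[i]^o).
Proof.
move=> [r01 ub].
apply: (@bisum_tannery _ (fun _ => u) _ C r id) => //.
- by move=> n; exact: cvg_cst.
- by near=> L => n _; exact: ub.
Unshelve. all: by end_near. Qed.

Lemma geom_boundedM C r u c : geom_bounded C r u ->
  geom_bounded (cabs c * C) r (fun n => c * u n).
Proof.
move=> [r01 ub]; split=> // n; have [h1 h2] := ub n.
by rewrite !cabsM -!mulrA !ler_wpM2l ?cabs_ge0.
Qed.

Lemma bisum_mull C r u c : geom_bounded C r u ->
  bisum (fun n => c * u n) = c * bisum u.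
Proof.
move=> ub; have c1 := cvg_bipart (geom_boundedM c ub).
have c2 : ((fun N => c * bipart u N) : nat -> R[i]^o) @ \oo --> (c * bisum u : R[i]^o).
  by apply: cvgM; [exact: cvg_cst | exact: cvg_bipart ub].
apply: (cvg_unique _ c1); first exact: norm_hausdorff.
apply: cvg_trans c2; apply: near_eq_cvg.
by near=> N; rewrite bipart_mull.
Unshelve. all: by end_near. Qed.

Lemma eq_bisum u v : (forall n, u n = v n) -> bisum u = bisum v.
Proof. by move=> uv; congr bisum; exact/funext. Qed.

(** The pairs of index n >= 1 add up to at most
    d / (1 - d) <= 2 d times the modulus of the leading pair. *)
Lemma bisum_first_pair C r u d : geom_bounded C r u -> 0 <= d <= 2^-1 ->
  (forall n : nat, cabs (u n%:Z + u (- n.+1%:Z)) <= cabs (u 0 + u (- 1)) * d ^+ n) ->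
  cabs (bisum u - (u 0 + u (- 1))) <= 2 * d * cabs (u 0 + u (- 1)).
Proof.
move=> ub /andP[d0 d2] hd.
set g := u 0 + u (- 1).
have c1 : ((fun N => bipart u N.+1 - g) : nat -> R[i]^o) @ \oo --> (bisum u - g : R[i]^o).
  have cu : ((fun N => bipart u N.+1) : nat -> R[i]^o) @ \oo --> (bisum u : R[i]^o).
    by have := cvg_bipart ub; rewrite -cvg_shiftS.
  exact: (cvgB cu (cvg_cst _)).
have /cvg_cabs c2 := c1.
apply: (cvgr_to_le c2); near=> N.
rewrite /bipart big_nat_recl // -/g addrC addrA addNr add0r.
have tail M : cabs (\sum_(0 <= i < M) (u i.+1%:Z + u (- i.+2%:Z))) <=
   cabs g * \sum_(0 <= i < M) d ^+ i.+1.
  elim: M => [|M IH].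
    by rewrite !big_nil mulr0 -(rmorph0 (real_complex R)) cabsC normr0.
  rewrite !big_nat_recr //= mulrDr (le_trans (cabsD _ _)) // lerD //.
apply: le_trans (tail N) _; rewrite mulrC ler_wpM2r ?cabs_ge0 //.
(* the geometric sum, kept free of divisions *)
have geo M : (1 - d) * \sum_(0 <= i < M) d ^+ i.+1 = d - d ^+ M.+1.
  elim: M => [|M IH]; first by rewrite big_nil mulr0 expr1 subrr.
  by rewrite big_nat_recr //= mulrDr IH !exprS; ring.
have s0 : 0 <= \sum_(0 <= i < N) d ^+ i.+1.
  by apply: sumr_ge0 => i _; exact: exprn_ge0.
have := geo N; have : 0 <= d ^+ N.+1 by exact: exprn_ge0.
move: s0; set S := \sum_(0 <= i < N) _; nra.
Unshelve. all: by end_near. Qed.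

End Bisum.

Section GaussPairs.
Variable R : realType.
Implicit Types (z w : R[i]) (t : R).

Lemma gauss_geom_bounded z t : 0 < t -> 0 <= complex.Re z <= pi ->
  exists C, geom_bounded C (expR (- t^-1)) (gauss_term z t).
Proof.
move=> t0 zpi; exists (expR (complex.Im z ^+ 2 / t)); split.
  by rewrite expR_ge0 /= -expR0 ltr_expR oppr_lt0 invr_gt0.
have tV : 0 <= t^-1 by rewrite invr_ge0 ltW.
have E k : cabs (gauss_term z t k) = expR (complex.Im z ^+ 2 / t) *
    expR (- (complex.Re z + k%:~R * pi) ^+ 2 / t).
  rewrite cabs_cexp Re_divC -expRD; congr expR; rewrite -mulrDl; congr (_ / _).
  rewrite -(rmorph_int (real_complex R)) -rmorphM.
  by case: (z) => a b /=; rewrite expr2 /=; ring.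
move=> n; have [h1 h2] := sqr_shift_ge n zpi.
by split; rewrite E ler_wpM2l ?expR_ge0 // -expRM_natl ler_expR mulrN mulNr lerN2;
  exact: ler_wpM2r.
Qed.

Lemma theta3_geom_bounded z t : 0 < t ->
  exists C, geom_bounded C (expR (- 1)) (theta3_term z t).
Proof.
move=> t0; set y := `|complex.Im z|.
exists (expR ((2 * y + 1) ^+ 2 / (4 * t))); split.
  by rewrite expR_ge0 /= -expR0 ltr_expR.
have E (k : int) : cabs (theta3_term z t k) <= expR ((2 * y + 1) ^+ 2 / (4 * t)) * expR (- 1) ^+ `|k|.
  rewrite cabsM cabsC ger0_norm ?expR_ge0 // -expRM_natl -expRD.
  apply: le_trans (ler_wpM2l (expR_ge0 _) (cabs_theta3_exp z k)) _.
  rewrite -expRD ler_expR mulrN1.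
  have -> : k%:~R ^+ 2 = `|k|%N%:R ^+ 2 :> R.
    by rewrite natr_absz intr_norm real_normK ?num_real.
  exact: quadratic_dominates.
move=> n; split; first exact: E.
apply: le_trans (E _) _; rewrite abszN /= ler_wpM2l ?expR_ge0 // exprSr.
by rewrite ler_piMr ?exprn_ge0 ?expR_ge0 // -expR0 ler_expR.
Qed.

(** Let A = exp (-w^2/t), P = exp ((2 pi w - pi^2)/t), Q = 1/P and
    rho = exp (-pi^2/t). The terms of index n and -n-1 are A Q^n rho^(n^2+n) and
    A P^(n+1) rho^(n^2+n). Their combination is
    A Q^n rho^(n^2+n) (1 + e P^(2n+1)), and the quotient of 1 + e P^(2n+1) by
    1 + e P is the sum of the powers of - e P of exponents 0 to 2n. As 0 <= Re w <= pi puts the modulus of P between rho and 1/rho, the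
    cofactor is at most (2n+1) rho^(n^2), which is at most (3 t)^n because 2n+1 <= 3^n and
    rho <= exp (-1/t) <= t. *)
Lemma gauss_pair w t (e : R[i]) n : 0 < t -> 0 <= complex.Re w <= pi -> e ^+ 2 = 1 ->
  cabs (gauss_term w t n%:Z + e * gauss_term w t (- n.+1%:Z)) <=
  cabs (gauss_term w t 0 + e * gauss_term w t (- 1)) * (3 * t) ^+ n.
Proof.
move=> t0 /andP[x0 xpi] e2; have pi0 := pi_gt0 R.
have tC := realC_neq0 t0.
pose A := cexp (- w ^+ 2 / t%:C).
pose P := cexp ((2 * pi%:C * w - pi%:C ^+ 2) / t%:C).
pose Q := cexp (- ((2 * pi%:C * w - pi%:C ^+ 2) / t%:C)).
pose rho := cexp (- (pi%:C ^+ 2 / t%:C)).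
have PQ : P * Q = 1 by exact: cexpNK.
have E1 : gauss_term w t n%:Z = A * Q ^+ n * rho ^+ (n ^ 2 + n).
  rewrite /gauss_term /A /Q /rho -!cexpMn -!cexpD; congr cexp.
  rewrite -[n%:~R]/(n%:R) natrD natrX; move: (pi%:C) (t%:C) tC => p s s0; by field.
have E2 : gauss_term w t (- n.+1%:Z) = A * P ^+ n.+1 * rho ^+ (n ^ 2 + n).
  rewrite /gauss_term /A /P /rho -!cexpMn -!cexpD; congr cexp.
  rewrite intrN -[n.+1%:~R]/(n.+1%:R) -natr1 natrD natrX.
  move: (pi%:C) (t%:C) tC => p s s0; by field.
have E3 : gauss_term w t 0 = A by rewrite /gauss_term mul0r addr0.
have E4 : gauss_term w t (- 1) = A * P.
  rewrite /gauss_term /A /P -cexpD; congr cexp.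
  by rewrite intrN; move: (pi%:C) (t%:C) tC => p s s0; field.
have geo : 1 + e * P ^+ (2 * n).+1 = (1 + e * P) * \sum_(i < (2 * n).+1) (- (e * P)) ^+ i.
  have := subrX1 (- (e * P)) (2 * n).+1.
  have -> : (- (e * P)) ^+ (2 * n).+1 = - (e * P ^+ (2 * n).+1).
    rewrite exprNn exprMn !exprS !exprM sqrrN expr1n e2 expr1n; ring.
  move=> H; apply: oppr_inj; rewrite opprD addrC H; ring.
have fac : gauss_term w t n%:Z + e * gauss_term w t (- n.+1%:Z) =
   (gauss_term w t 0 + e * gauss_term w t (- 1)) *
   (rho ^+ (n ^ 2 + n) * (Q ^+ n * \sum_(i < (2 * n).+1) (- (e * P)) ^+ i)).
  rewrite E1 E2 E3 E4.
  have -> : P ^+ n.+1 = Q ^+ n * P ^+ (2 * n).+1.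
    by rewrite (_ : (2 * n).+1 = n + n.+1)%N ?exprD ?mulrA -?exprMn ?[Q * P]mulrC ?PQ ?expr1n ?mul1r //; lia.
  have -> : A * Q ^+ n * rho ^+ (n ^ 2 + n) + e * (A * (Q ^+ n * P ^+ (2 * n).+1) * rho ^+ (n ^ 2 + n))
    = A * Q ^+ n * rho ^+ (n ^ 2 + n) * (1 + e * P ^+ (2 * n).+1) by ring.
  rewrite geo; ring.
rewrite fac cabsM ler_wpM2l ?cabs_ge0 //.
pose s := (2 * pi * complex.Re w - pi ^+ 2) / t.
pose k := pi ^+ 2 / t.
have Re_s : complex.Re ((2 * pi%:C * w - pi%:C ^+ 2) / t%:C) = s.
  rewrite Re_divC -rmorphXn -(rmorph_nat (real_complex R)) -rmorphM; congr (_ / _).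
  by case: (w) => a b /=; ring.
have aP : cabs P = expR s by rewrite cabs_cexp Re_s.
have aQ : cabs Q = expR (- s) by rewrite cabs_cexp raddfN /= Re_s.
have arho : cabs rho = expR (- k).
  have -> : rho = cexp (- k)%:C.
    by rewrite /rho /k rmorphN rmorphM fmorphV rmorphXn.
  by rewrite cexp_real cabsC ger0_norm ?expR_ge0.
have ae := cabs_involution e2.
have sk : `|s| <= k.
  rewrite normrM normfV (gtr0_norm t0) ler_wpM2r ?invr_ge0 ?(ltW t0) //.
  by rewrite ler_norml; apply/andP; split; nra.
have sumb : cabs (Q ^+ n * \sum_(i < (2 * n).+1) (- (e * P)) ^+ i) <= (2 * n).+1%:R * expR (k *+ n).
  rewrite -lecR -normCE mulr_sumr (le_trans (ler_norm_sum _ _ _)) //.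
  rewrite -[X in X%:R]card_ord -sum1_card natr_sum mulr_suml rmorph_sum.
  apply: ler_sum => i _; rewrite mul1r normrM !normrX normrN normrM !normCE.
  rewrite ae aP aQ mul1r -!rmorphXn -rmorphM lecR /=.
  rewrite -!expRM_natl -expRD ler_expR -[k *+ n]mulr_natl.
  have -> : n%:R * - s + i%:R * s = (i%:R - n%:R) * s by ring.
  rewrite (le_trans (ler_norm _)) // normrM; apply: ler_pM => //.
  rewrite ler_norml; have := ltn_ord i; rewrite ltnS -(ler_nat R) natrM => ?.
  have ? : 0 <= i%:R :> R by [].
  by apply/andP; split; lra.
rewrite cabsM cabsX arho.
apply: le_trans (ler_wpM2l _ sumb) _; first by rewrite exprn_ge0 ?expR_ge0.
have -> : expR (- k) ^+ (n ^ 2 + n) * ((2 * n).+1%:R * expR (k *+ n)) =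
   (2 * n).+1%:R * expR (- (k *+ n ^ 2)).
  rewrite mulrCA; congr (_ * _); rewrite -expRM_natl -expRD; congr expR.
  by rewrite natrD -[k *+ n]mulr_natl -[k *+ (n ^ 2)]mulr_natl; ring.
rewrite exprMn; apply: ler_pM => //; rewrite ?expR_ge0 //.
  rewrite -natrX ler_nat; elim: (n) => // m IH; rewrite expnS; lia.
have k1 : t^-1 <= k.
  rewrite -[leLHS]mul1r ler_wpM2r ?invr_ge0 ?(ltW t0) //.
  by rewrite expr_ge1 // ?(le_trans _ (pi_ge2 R)) ?ler1n // ltW.
have kt : expR (- k) <= t.
  rewrite expRN -[leRHS]invrK lef_pV2 ?posrE ?expR_gt0 ?invr_gt0 //.
  by rewrite (le_trans k1) // (le_trans _ (expR_ge1Dx _)) // lerDr.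
apply: le_trans (_ : expR (- k) ^+ n <= _).
  rewrite -expRM_natl ler_expR mulrN lerN2 -[k *+ _]mulr_natl ler_wpM2r //.
    by rewrite (le_trans _ k1) // invr_ge0 ltW.
  by rewrite ler_nat; case: (n) => // m; nia.
by rewrite lerXn2r ?nnegrE ?expR_ge0 // ltW.
Qed.

End GaussPairs.

(** * Transformation of theta2 and theta3, and the asymptotics *)

Section ThetaGauss.
Variable R : realType.
Implicit Types (z w : R[i]) (t q : R) (e : R[i]).

Lemma cexpN_inv z : cexp (- z) = (cexp z)^-1.
Proof. by apply: (mulfI (cexp_neq0 z)); rewrite cexpNK divff // cexp_neq0. Qed.

Lemma cexp_add2pi z (n : int) : cexp (z + 'i%C * (2 * n)%:~R * pi%:C) = cexp z.
Proof. by rewrite cexpD cexp_2pi mulr1. Qed.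

Lemma cexp_ipi (n : int) : cexp ('i%C * n%:~R * pi%:C) = (-1) ^ n :> R[i].
Proof.
have E1 : cexp ('i%C * pi%:C) = -1 :> R[i].
  rewrite /cexp /= !mul0r mulr0 subr0 expR0 !mul1r !add0r cospi sinpi.
  by apply/eqP; rewrite eq_complex /= oppr0 !eqxx.
have H k : cexp ('i%C * (k%:Z)%:~R * pi%:C) = (-1) ^+ k :> R[i].
  by rewrite -E1 -cexpMn; congr cexp; rewrite -[k%:~R]/(k%:R); ring.
case: n => k; first exact: H.
rewrite NegzE intrN mulrN mulNr cexpN_inv H.
by rewrite exprnN.
Qed.

(** Completing the square, (n + 1/2)^2 t = n^2 t + n t + t/4, and absorbing
    exp (- n t) into a shift of the argument by i t / 2. *)
Lemma theta2_term_factor z w t (N n : int) : z = w + N%:~R * pi%:C ->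
  (expR (- ((n%:~R + 2^-1) ^+ 2 * t)))%:C * cexp ('i%C * (2 * n + 1)%:~R * z) =
  ((-1) ^ N * (expR (- (t / 4)))%:C * cexp ('i%C * w)) *
  theta3_term (w + 'i%C * (t / 2)%:C) t n.
Proof.
move=> ->; rewrite /theta3_term -cexp_ipi -!cexp_real -!cexpD.
rewrite -[LHS](cexp_add2pi _ (- (n * N))); congr cexp.
have ii : 'i%C * 'i%C = -1 :> R[i] by rewrite -expr2 sqr_i.
have -> : 'i%C * (2 * n)%:~R * (w + 'i%C * (t / 2)%:C) =
   'i%C * (2 * n)%:~R * w - (n%:~R * t)%:C.
  rewrite mulrDr; congr (_ + _).
  rewrite mulrACA ii mulN1r; congr (- _).
  by rewrite !rmorphM fmorphV /= !rmorph_int !rmorph_nat; field.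
have -> : (- ((n%:~R + 2^-1) ^+ 2 * t))%:C = - ((n%:~R + 2^-1) ^+ 2 * t%:C).
  by rewrite rmorphN rmorphM rmorphXn rmorphD fmorphV rmorph_int rmorph_nat.
have -> : (- (t / 4))%:C = - (t%:C / 4) by rewrite rmorphN rmorphM fmorphV rmorph_nat.
have -> : (- (n%:~R ^+ 2 * t))%:C = - (n%:~R ^+ 2 * t%:C).
  by rewrite rmorphN rmorphM rmorphXn rmorph_int.
have -> : (n%:~R * t)%:C = n%:~R * t%:C by rewrite rmorphM rmorph_int.
rewrite intrD [(2 * - _)%:~R]intrM intrN !intrM.
by field.
Qed.

(** The cross term of the square contributes exp (- i (w + k pi)), hence the sign
    (-1)^k. *)
Lemma gauss_term_half_shift w t (k : int) : 0 < t ->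
  gauss_term (w + 'i%C * (t / 2)%:C) t k =
  ((expR (t / 4))%:C * cexp (- ('i%C * w))) * ((-1) ^ k * gauss_term w t k).
Proof.
move=> t0; have tC := realC_neq0 t0.
rewrite /gauss_term -cexp_ipi -!cexp_real -!cexpD.
rewrite -[RHS](cexp_add2pi _ (- k)); congr cexp.
have ii : 'i%C ^+ 2 = -1 :> R[i] by rewrite sqr_i.
have -> : - (w + 'i%C * (t / 2)%:C + k%:~R * pi%:C) ^+ 2 =
   - (w + k%:~R * pi%:C) ^+ 2 - 'i%C * t%:C * (w + k%:~R * pi%:C) + t%:C ^+ 2 / 4.
  have -> : (t / 2)%:C = t%:C / 2 by rewrite rmorphM fmorphV rmorph_nat.
  rewrite (_ : t%:C ^+ 2 / 4 = - ('i%C ^+ 2) * (t%:C ^+ 2 / 4)); last by rewrite ii opprK mul1r.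
  by field.
have -> : (t / 4)%:C = t%:C / 4 by rewrite rmorphM fmorphV rmorph_nat.
rewrite mulrN intrN intrM.
by move: (t%:C) tC (pi%:C) => s s0 p; field.
Qed.

Lemma mod_piE z : z = mod_pi z + (floor_pi z)%:~R * pi%:C.
Proof. by rewrite /mod_pi subrK. Qed.

Lemma Re_mod_pi z : 0 <= complex.Re (mod_pi z) <= pi.
Proof.
have pi0 := pi_gt0 R.
have -> : complex.Re (mod_pi z) = complex.Re z - (floor_pi z)%:~R * pi.
  by rewrite /mod_pi -(rmorph_int (real_complex R)) -rmorphM raddfB.
have := floor_le_tmp (complex.Re (z / pi%:C)).
have := floorD1_gt (complex.Re (z / pi%:C)).
rewrite -/(floor_pi z) Re_divC intrD ltr_pdivrMr // ler_pdivlMr // => h1 h2.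
by apply/andP; split; lra.
Qed.

Lemma powR_expR q a : 0 < q -> q `^ a = expR (- (a * ln (1 / q))).
Proof.
move=> q0; rewrite /powR gt_eqF // div1r lnV ?posrE // mulrN opprK //.
Qed.

Lemma ln_inv_gt0 q : 0 < q < 1 -> 0 < ln (1 / q).
Proof.
by move=> /andP[q0 q1]; rewrite div1r lnV ?posrE // oppr_gt0 ln_lt0 // q0.
Qed.

Lemma theta3_gauss z q : 0 < q < 1 ->
  theta3 z q = (Num.sqrt (pi / ln (1 / q)))%:C *
    bisum (gauss_term (mod_pi z) (ln (1 / q))).
Proof.
move=> q01; have t0 := ln_inv_gt0 q01; have /andP[q0 _] := q01.
rewrite -jacobi_identity ?Re_mod_pi //; apply: eq_bisum => n.
rewrite powR_expR // /theta3_term; congr (_ * _).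
rewrite {1}(mod_piE z) mulrDr cexpD.
rewrite [X in cexp _ * cexp X](_ : _ = 'i%C * (2 * (n * floor_pi z))%:~R * pi%:C).
  by rewrite cexp_2pi mulr1.
by rewrite !intrM; ring.
Qed.

(** The prefactor exp (-t/4) exp (i w) of theta2_term_factor cancels the one of
    gauss_term_half_shift. *)
Lemma theta2_gauss z q : 0 < q < 1 ->
  theta2 z q = (Num.sqrt (pi / ln (1 / q)))%:C *
    bisum (fun k => (-1) ^ k * gauss_term (mod_pi z) (ln (1 / q)) k) * (-1) ^ floor_pi z.
Proof.
move=> q01; have t0 := ln_inv_gt0 q01; have /andP[q0 _] := q01.
set t := ln (1 / q) in t0 *; set w := mod_pi z; set N := floor_pi z.
pose c := (-1) ^ N * (expR (- (t / 4)))%:C * cexp ('i%C * w).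
pose w' := w + 'i%C * (t / 2)%:C.
have Rw' : complex.Re w' = complex.Re w.
  by rewrite /w' raddfD /= mul0r mulr0 subrr addr0.
have wpi : 0 <= complex.Re w' <= pi by rewrite Rw' Re_mod_pi.
have [C1 b1] := theta3_geom_bounded w' t0.
have -> : theta2 z q = c * bisum (theta3_term w' t).
  rewrite -(bisum_mull _ b1); apply: eq_bisum => n.
  by rewrite powR_expR // -/t; apply: theta2_term_factor; exact: mod_piE.
rewrite jacobi_identity //.
have [C2 b2] := gauss_geom_bounded t0 wpi.
pose c' := (expR (t / 4))%:C * cexp (- ('i%C * w)).
have cc' : c * c' = (-1) ^ N.
  rewrite /c /c' mulrACA cexpNK mulr1 -mulrA -rmorphM -expRD addNr expR0 mulr1 //.
have c'0 : c' != 0.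
  apply/eqP => c0; move: cc'; rewrite c0 mulr0 => /esym /eqP.
  by rewrite -cexp_ipi (negPf (cexp_neq0 _)).
have -> : bisum (fun k => (-1) ^ k * gauss_term w t k) = c'^-1 * bisum (gauss_term w' t).
  rewrite -(bisum_mull _ b2); apply: eq_bisum => k.
  by rewrite gauss_term_half_shift // mulKf.
rewrite -cc'; move: (bisum _) => B.
by field.
Qed.

Lemma gauss_bisum_first_pair w t e : 0 < t <= 6^-1 -> 0 <= complex.Re w <= pi ->
  e ^+ 2 = 1 ->
  cabs (bisum (fun k => e ^ k * gauss_term w t k) -
        (gauss_term w t 0 + e * gauss_term w t (- 1))) <=
  6 * t * cabs (gauss_term w t 0 + e * gauss_term w t (- 1)).
Proof.
move=> /andP[t0 t6] wpi e2.
have eV : e^-1 = e.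
  have e0 : e != 0 by apply/eqP => e0; move/eqP: e2; rewrite e0 expr0n eq_sym oner_eq0.
  by apply: (mulfI e0); rewrite divff // -expr2 e2.
have ae := cabs_involution e2.
have eN (n : nat) : e ^ (- n.+1%:Z) = e ^+ n.+1 by rewrite -exprnN -exprVn eV.
pose u k := e ^ k * gauss_term w t k.
have u0 : u 0 + u (- 1) = gauss_term w t 0 + e * gauss_term w t (- 1).
  by rewrite /u expr0z mul1r (eN 0%N) expr1.
have [C [r01 b]] := gauss_geom_bounded t0 wpi.
have ub : geom_bounded C (expR (- t^-1)) u.
  split=> // n; rewrite /u eN !cabsM !cabsX ae !expr1n !mul1r; exact: b.
have d2 : 0 <= 3 * t <= 2^-1 by apply/andP; split; lra.
have := bisum_first_pair ub d2.
rewrite u0 (_ : 2 * (3 * t) = 6 * t); last by ring.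
apply=> n.
have -> : u n%:Z + u (- n.+1%:Z) = e ^+ n * (gauss_term w t n%:Z + e * gauss_term w t (- n.+1%:Z)).
  by rewrite /u eN exprS mulrDr mulrA [e ^+ n * e]mulrC.
by rewrite cabsM cabsX ae expr1n mul1r; exact: gauss_pair.
Qed.

(** As q -> 1 the relative error 6 ln (1/q) tends to 0. *)
Lemma asymp_eq1_relative_error (f g : R -> R[i]) :
  (forall q, 0 < q < 1 -> ln (1 / q) <= 6^-1 ->
     cabs (f q - g q) <= 6 * ln (1 / q) * cabs (g q)) -> asymp_eq1 f g.
Proof.
move=> fg; rewrite /asymp_eq1; apply/eqaddoP => eps eps0.
have epsE : eps = (complex.Re eps)%:C by rewrite RRe_real // gtr0_real.
have e0 : 0 < complex.Re eps by rewrite -ltcR -epsE.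
pose d := Num.min 6^-1 (complex.Re eps / 6).
have d0 : 0 < d by rewrite /d lt_min; apply/andP; split; [rewrite invr_gt0 | exact: divr_gt0].
near=> q.
have q1 : q < 1 by near: q; exact: nbhs_left_lt.
have qd : expR (- d) < q.
  by near: q; apply: nbhs_left_gt; rewrite -expR0 ltr_expR oppr_lt0.
have q0 : 0 < q by rewrite (lt_trans _ qd) // expR_gt0.
have td : ln (1 / q) <= d.
  rewrite div1r lnV ?posrE // lerNl -[leLHS]expRK ler_ln ?posrE ?expR_gt0 //.
  exact: ltW.
have [td1 td2] : ln (1 / q) <= 6^-1 /\ ln (1 / q) <= complex.Re eps / 6.
  by move: td; rewrite /d le_min => /andP[].
rewrite epsE -[`|(f - g) q|]/(`|f q - g q|) !normCE -rmorphM lecR.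
apply: le_trans (fg q _ td1) _; first by rewrite q0.
by rewrite ler_wpM2r ?cabs_ge0 //; lra.
Unshelve. all: by end_near. Qed.

Lemma gauss_term0E w q : 0 < q -> gauss_term w (ln (1 / q)) 0 = cexp (w ^+ 2 / (ln q)%:C).
Proof.
move=> q0; rewrite /gauss_term mul0r addr0 div1r lnV ?posrE // rmorphN.
by rewrite invrN mulrNN.
Qed.

Lemma gauss_termN1E w q : 0 < q ->
  gauss_term w (ln (1 / q)) (- 1) = cexp ((pi%:C - w) ^+ 2 / (ln q)%:C).
Proof.
move=> q0; rewrite /gauss_term intrN mulN1r div1r lnV ?posrE // rmorphN.
by rewrite invrN mulrNN -sqrrN opprB.
Qed.

Lemma theta3_asymptotic z : asymp_eq1 (theta3 z) (theta3_asymp z).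
Proof.
apply: asymp_eq1_relative_error => q q01 t6.
have t0 := ln_inv_gt0 q01; have /andP[q0 _] := q01.
rewrite theta3_gauss // /theta3_asymp -gauss_term0E // -gauss_termN1E //.
set K := (Num.sqrt _)%:C; rewrite -mulrBr !cabsM mulrCA ler_wpM2l ?cabs_ge0 //.
have := @gauss_bisum_first_pair (mod_pi z) (ln (1 / q)) 1.
rewrite t0 t6 Re_mod_pi expr1n => /(_ isT isT erefl).
rewrite ![1 * gauss_term _ _ _]mul1r; congr (cabs (_ - _) <= _).
by apply: eq_bisum => k; rewrite exp1rz mul1r.
Qed.

Lemma theta2_asymptotic z : asymp_eq1 (theta2 z) (theta2_asymp z).
Proof.
apply: asymp_eq1_relative_error => q q01 t6.
have t0 := ln_inv_gt0 q01; have /andP[q0 _] := q01.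
rewrite theta2_gauss // /theta2_asymp -gauss_term0E // -gauss_termN1E //.
set K := (Num.sqrt _)%:C; set S := (-1) ^ _.
rewrite -mulrBl -mulrBr !cabsM mulrA ler_wpM2r ?cabs_ge0 //.
rewrite mulrCA ler_wpM2l ?cabs_ge0 //.
have := @gauss_bisum_first_pair (mod_pi z) (ln (1 / q)) (-1).
by rewrite t0 t6 Re_mod_pi sqrrN expr1n mulN1r => /(_ isT isT erefl).
Qed.

End ThetaGauss.

Theorem theorem7p1 (R : realType) (z : R[i]) :
  [/\ forall q : R, 0 <= q < 1 -> theta1 (z + (pi / 2)%:C) q = theta2 z q,
      asymp_eq1 (theta1 (z + (pi / 2)%:C)) (theta2_asymp z) &
      asymp_eq1 (theta2 z) (theta2_asymp z)] /\
  [/\ forall q : R, 0 <= q < 1 -> theta3 z q = theta4 (z + (pi / 2)%:C) q,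
      asymp_eq1 (theta3 z) (theta3_asymp z) &
      asymp_eq1 (theta4 (z + (pi / 2)%:C)) (theta3_asymp z)].
Proof.
have t12 : theta1 (z + (pi / 2)%:C) = theta2 z.
  by apply/funext => q; rewrite /theta1 addrK.
have t43 : theta4 (z + (pi / 2)%:C) = theta3 z.
  by apply/funext => q; rewrite /theta4 addrK.
rewrite t12 t43; split; split.
- by move=> q _; reflexivity.
- exact: theta2_asymptotic.
- exact: theta2_asymptotic.
- by move=> q _; reflexivity.
- exact: theta3_asymptotic.
- exact: theta3_asymptotic.
Qed.
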